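(* Let $r\ge1$. The minimal distance between roots of any type II multiple Hahn polynomial $P_{\bm{n}}^{\bm{\alpha};\beta;N}$ with $|\bm{n}|<N$, of any type II multiple Krawtchouk polynomial $P_{\bm{n}}^{N;\bm{p}}$ with $|\bm{n}|<N$, or of any type II multiple Charlier polynomial $P_{\bm{n}}^{\bm{a}}$, is larger than $1$. The minimal distance between roots of any type II multiple Meixner polynomial of the first kind $P_{\bm{n}}^{\bm{c};\beta}$ or of the second kind $P_{\bm{n}}^{c;\bm{\beta}}$ is not smaller than $1$.
   Context: The minimal distance between roots of a polynomial is the smallest distance between two consecutive roots. For a system of positive measures $(\mu_1,\dots,\mu_r)$ on $\mathbb{R}$ with finite moments and $\bm{n}\in\mathbb{N}^r$ ($\mathbb{N}=\{0,1,\dots\}$), $|\bm{n}|=\sum n_j$, a type II multiple orthogonal polynomial $P_{\bm{n}}$ is a nonzero polynomial of degree at most $|\bm{n}|$ with $\int P_{\bm{n}}(x)x^p\,d\mu_j(x)=0$ for $0\le p\le n_j-1$, $1\le j\le r$; when every such polynomial has degree exactly $|\bm{n}|$ (normal index), $P_{\bm{n}}$ denotes the unique monic one. $\delta_k$ is the unit point mass at $k$; $(x)_0=1$, $(x)_k=x(x+1)\cdots(x+k-1)$. Multiple Charlier, $P_{\bm{n}}^{\bm{a}}$: $\mu_j=\sum_{k=0}^\infty\frac{a_j^k}{k!}\delta_k$, $a_j>0$, $a_j\ne a_s$ for $j\ne s$. Multiple Meixner of the first kind, $P_{\bm{n}}^{\bm{c};\beta}$: $\mu_j=\sum_{k=0}^\infty\frac{(\beta)_kc_j^k}{k!}\delta_k$,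 $\beta>0$, $0<c_j<1$, $c_j\neq c_s$ for $j\ne s$. Multiple Meixner of the second kind, $P_{\bm{n}}^{c;\bm{\beta}}$: $\mu_j=\sum_{k=0}^\infty\frac{(\beta_j)_kc^k}{k!}\delta_k$, $\beta_j>0$, $0<c<1$, $\beta_j-\beta_s\notin\mathbb{Z}$ for $j\neq s$. Multiple Krawtchouk, $P_{\bm{n}}^{N;\bm{p}}$: $\mu_j=\sum_{k=0}^N\binom Nk p_j^k(1-p_j)^{N-k}\delta_k$, $N\in\{1,2,\dots\}$, $0<p_j<1$, $p_j-p_s\ne 0$ for $j\ne s$. Multiple Hahn, $P_{\bm{n}}^{\bm{\alpha};\beta;N}$: $\mu_j=\sum_{k=0}^N\frac{(\alpha_j+1)_k(\beta+1)_{N-k}}{k!(N-k)!}\delta_k$, $N\in\{1,2,\dots\}$, $\beta>-1$, $\alpha_j>-1$, $\alpha_j-\alpha_s\ne 0$ for $j\ne s$.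
   Formalization: For multiple Hahn polynomials the index n is assumed normal, because with only α_j ≠ α_s the claim fails: for α = (a, a+1, a+2), n = (3,1,1), N = 6 some type II polynomial vanishes at both 0 and 1/2. *)

(* Defs.v *)
From HB Require Import structures.
From mathcomp Require Import all_boot all_order all_algebra.
From mathcomp Require Import all_classical all_reals all_analysis.

Set Implicit Arguments.
Unset Strict Implicit.
Unset Printing Implicit Defensive.

Import Order.TTheory GRing.Theory Num.Theory.

Local Open Scope classical_set_scope.
Local Open Scope ring_scope.

Section DiscreteMeasures.
Context {R : realType}.
Implicit Types (w : nat -> R) (N k : nat) (x : R).

(* The measure w_k \delta_k.  The norm is there only because [mscale] wants a
   nonnegative scalar: every weight below is nonnegative on the parameter
   ranges where it is used. *)
Definition point_mass w k : {measure set (measurableTypeR R) -> \bar R} :=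
  mscale `|w k|%:nng (dirac (k%:R : measurableTypeR R)).

Definition discrete_measure w : {measure set (measurableTypeR R) -> \bar R} :=
  mseries (point_mass w) 0.

(* Masses at 0, ..., N, both ends included. *)
Definition finite_discrete_measure N w :
  {measure set (measurableTypeR R) -> \bar R} :=
  msum (point_mass w) N.+1.

Definition pochhammer x k : R := \prod_(i < k) (x + i%:R).

Definition charlier_measure (a : R) :=
  discrete_measure (fun k => a ^+ k / (k`!)%:R).

Definition meixner_measure (beta c : R) :=
  discrete_measure (fun k => pochhammer beta k * c ^+ k / (k`!)%:R).

Definition krawtchouk_measure N (p : R) :=
  finite_discrete_measure N
    (fun k => 'C(N, k)%:R * p ^+ k * (1 - p) ^+ (N - k)).

Definition hahn_measure (alpha beta : R) N :=
  finite_discrete_measure N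
    (fun k => pochhammer (alpha + 1) k * pochhammer (beta + 1) (N - k)
              / ((k`!)%:R * ((N - k)`!)%:R)).

End DiscreteMeasures.

Section MultipleOrthogonality.
Context {R : realType} {r : nat}.
Implicit Types (n : 'I_r -> nat) (P : {poly R}).
Implicit Type mu : 'I_r -> {measure set (measurableTypeR R) -> \bar R}.

Definition multi_size n : nat := \sum_(j < r) n j.

Definition type_II mu n P : Prop :=
  [/\ P != 0,
      (size P <= (multi_size n).+1)%N &
      forall (j : 'I_r) (p : nat), (p < n j)%N ->
        (\int[mu j]_x (P.[x] * x ^+ p)%:E = 0)%E].

Definition normal_index mu n : Prop :=
  forall P, type_II mu n P -> size P = (multi_size n).+1.

End MultipleOrthogonality.

Section RootDistance.
Context {R : realType}.
Implicit Types (P : {poly R}) (s : seq R).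

(* s lists, in nondecreasing order and with multiplicity, all the (complex)
   roots of P; such an s exists only when P is real-rooted. *)
Definition ordered_roots P s : Prop :=
  sorted <=%R s /\ P = lead_coef P *: \prod_(x <- s) ('X - x%:P).

(* Equal to +oo when s has fewer than two terms. *)
Definition min_gap s : \bar R :=
  \big[Order.min/+oo%E]_(i < (size s).-1) (s`_i.+1 - s`_i)%:E.

Definition min_root_distance P (d : \bar R) : Prop :=
  exists2 s, ordered_roots P s & d = min_gap s.

End RootDistance.

(* Main.v *)
Require Import Defs.
From HB Require Import structures.
From mathcomp Require Import all_boot all_order all_algebra.
From mathcomp Require Import all_classical all_reals all_analysis.
From mathcomp Require Import measurable_realfun.
From mathcomp Require polyrcf.
From mathcomp Require Import ring lra.

(* The polynomials are built from 1 by raising operators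
   f |-> U(x) f(x - 1) - V(x) f(x), with U and V positive where it matters.
   If f has simple positive roots x_1 < ... < x_m at distance more than 1 from
   each other, evaluating at x_i and x_i + 1 shows that the new roots
   y_1 < ... < y_(m+1) satisfy y_i < x_i < x_i + 1 < y_(i+1), so the gaps stay
   larger than 1.

   That type II polynomials have this form is read off their moments.  Write
   L_t(P) for the integral of P divided by the mass, as a function of the
   parameter t of the weight.  For Charlier, Krawtchouk and both Meixner
   families L_t(P) is a polynomial in t (t = c / (1 - c) for the first Meixner
   family) of degree at most deg P, on which the raising operator acts as
   multiplication by t - t_0.  Orthogonality makes L_t(P) vanish to order n_j at
   t_j, or, for the second Meixner family, at beta_j, ..., beta_j + n_j - 1;
   this determines it, hence P, up to a constant.  For Hahn the raising chain is
   orthogonal by summation by parts and uniqueness is the normality of the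
   index. *)

Set Implicit Arguments.
Unset Strict Implicit.
Unset Printing Implicit Defensive.

Import Order.TTheory GRing.Theory Num.Theory.
Import numFieldNormedType.Exports.

Local Open Scope ring_scope.

(** * How a raising operator moves the roots *)

Section Roots.
Context {R : realType}.
Implicit Types (f g U V : {poly R}) (s : seq R) (x y z B c : R).

Definition gap1 x y := x + 1 < y.

Lemma gap1_trans : transitive gap1.
Proof. by move=> y x z; rewrite /gap1; lra. Qed.

Definition raise U V f : {poly R} := U * (f \Po ('X - 1%:P)) - V * f.

Lemma raiseE U V f x :
  (raise U V f).[x] = U.[x] * f.[x - 1] - V.[x] * f.[x].
Proof. by rewrite /raise !hornerE horner_comp !hornerE. Qed.

Lemma prod_XsubC_sign_lt s z : (forall x, x \in s -> z < x) ->
  0 < (-1) ^+ size s * (\prod_(x <- s) ('X - x%:P)).[z].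
Proof.
elim: s => [|x s IHs] zs /=; first by rewrite big_nil hornerC mulr1 ltr01.
rewrite big_cons hornerM exprS mulrACA mulr_gt0 ?IHs //.
  by rewrite !hornerE mulN1r opprB subr_gt0 zs ?mem_head.
by move=> y ys; rewrite zs // in_cons ys orbT.
Qed.

Lemma prod_XsubC_sign s z i : (i <= size s)%N ->
    (forall k, (k < i)%N -> s`_k < z) ->
    (forall k, (i <= k < size s)%N -> z < s`_k) ->
  0 < (-1) ^+ (size s - i) * (\prod_(x <- s) ('X - x%:P)).[z].
Proof.
move=> les sl sr; rewrite -{2}(cat_take_drop i s) big_cat hornerM mulrCA.
apply: mulr_gt0; last first.
  rewrite -size_drop; apply: prod_XsubC_sign_lt => x /(nthP 0)[k].
  by rewrite size_drop nth_drop => ki <-; rewrite sr// leq_addr -ltn_subRL.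
rewrite horner_prod big_seq; apply: prodr_gt0 => x /(nthP 0)[k].
rewrite size_takel// => ki; rewrite nth_take// => <-.
by rewrite !hornerE subr_gt0 sl.
Qed.

(* The roots of [raise U V f] are trapped in the intervals bounded by [0], the
   pairs [x_i], [x_i + 1] and [B]; none lies between [x_i] and [x_i + 1], which
   is what separates consecutive ones by more than 1. *)
Lemma raise_roots U V f s c B :
    0 < c -> f = c *: \prod_(x <- s) ('X - x%:P) -> sorted gap1 s ->
    (forall x, x \in s -> 0 < x < B - 1) -> 0 < B ->
    U.[0] = 0 -> (forall x, 0 < x < B -> 0 < U.[x]) ->
    (forall x, 0 <= x < B -> 0 < V.[x]) ->
    0 < (raise U V f).[B] -> (size (raise U V f) <= (size s).+2)%N ->
  exists s' c', [/\ 0 < c', raise U V f = c' *: \prod_(x <- s') ('X - x%:P),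
    sorted gap1 s', (forall x, x \in s' -> 0 < x < B) &
    size s' = (size s).+1].
Proof.
set g := raise U V f; set m := size s.
move=> c0 fE sg sB B0 U0 Upos Vpos gB gs.
have ss i : (i < m)%N -> 0 < s`_i < B - 1 by move=> im; rewrite sB ?mem_nth.
have sS i j : (i < j)%N -> (j < m)%N -> s`_i + 1 < s`_j.
  move=> ij jm; apply: (sorted_ltn_nth gap1_trans 0 sg) => //.
  by rewrite inE; exact: ltn_trans jm.
pose lo i := if i is j.+1 then s`_j + 1 else 0.
pose hi i := if (i < m)%N then s`_i else B.
have lohi i : (i <= m)%N -> lo i < hi i.
  rewrite /lo /hi; case: i => [|j] jm.
    by case: ifP => [/ss/andP[]|].
  by case: ifP => im; [exact: sS|have := ss j jm; lra].
have lo0 i : (i <= m)%N -> 0 <= lo i.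
  by case: i => [|j] //= jm; have := ss j jm; lra.
have hiB i : hi i <= B.
  by rewrite /hi; case: ifP => // /ss; lra.
(* At [lo i] the term in [U] drops out: either [U] vanishes at 0, or [lo i - 1] is a root of [f].
   What remains is [- V f], where the sign of [f] is given by the [m - i] roots above [lo i]. *)
have glo i : (i <= m)%N -> (-1) ^+ (m - i) * g.[lo i] < 0.
  move=> im; rewrite raiseE.
  have -> : U.[lo i] * f.[lo i - 1] = 0.
    case: i im => [|j] jm /=; first by rewrite U0 mul0r.
    have /rootP fr : root f s`_j.
      by rewrite fE rootZ ?gt_eqF// root_prod_XsubC mem_nth.
    by rewrite addrK fr mulr0.
  rewrite sub0r mulrN oppr_lt0 mulrCA mulr_gt0 //.
    by rewrite Vpos// lo0//= (lt_le_trans (lohi _ im)).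
  rewrite fE hornerZ mulrCA mulr_gt0// prod_XsubC_sign// => k ki.
    rewrite /lo; case: i im ki => // j jm; rewrite ltnS leq_eqVlt.
    case/predU1P => [->|kj]; first lra.
    by have := sS _ _ kj jm; lra.
  have im' : (i < m)%N by case/andP: ki; exact: leq_ltn_trans.
  have := lohi i im; rewrite /hi im' => /lt_le_trans; apply.
  case/andP: ki; rewrite leq_eqVlt; case/predU1P => [->//|ik km].
  by have := sS _ _ ik km; lra.
(* At a root of [f] the term in [V] drops out. The gap condition keeps the point one unit to the
   left of that root above the preceding root, which fixes the sign of [f] there. For [i = m] this
   is the positivity at [B]. *)
have ghi i : (i <= m)%N -> 0 < (-1) ^+ (m - i) * g.[hi i].
  rewrite /hi leq_eqVlt; case/predU1P => [->|im].
    by rewrite ltnn subnn mul1r.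
  have sim := ss i im.
  rewrite im raiseE.
  have /rootP -> : root f s`_i.
    by rewrite fE rootZ ?gt_eqF// root_prod_XsubC mem_nth.
  rewrite mulr0 subr0 mulrCA mulr_gt0//; first by rewrite Upos//; lra.
  rewrite fE hornerZ mulrCA mulr_gt0// prod_XsubC_sign ?(ltnW im)// => k ki.
    by have := sS _ _ ki im; lra.
  case/andP: ki; rewrite leq_eqVlt; case/predU1P => [->|ik km]; first lra.
  by have := sS _ _ ik km; lra.
have yE i : exists y, (i <= m)%N -> lo i < y < hi i /\ root g y.
  case: (leqP i m) => im; last by exists 0.
  have /(polyrcf.poly_ivtoo (ltW (lohi i im)))[y] : g.[lo i] * g.[hi i] < 0.
    rewrite -[ltLHS]mul1r -[1](sqrr_sign _ (m - i)) expr2 mulrACA.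
    by rewrite pmulr_llt0 ?ghi ?glo.
  by rewrite in_itv /= => yi gy; exists y.
have [y yP] := boolp.choice yE.
pose s' := mkseq y m.+1.
have s'S : sorted gap1 s'.
  apply/(sortedP 0) => i; rewrite size_mkseq => im.
  rewrite !nth_mkseq ?(ltnW im) // /gap1.
  have [/andP[_ y1] _] := yP i (ltnW im).
  have [/andP[y2 _] _] := yP i.+1 im.
  by move: y1 y2; rewrite /hi /lo ltnS in im *; rewrite im; lra.
have s'B x : x \in s' -> 0 < x < B.
  move/mapP => [i]; rewrite mem_iota add0n => /andP[_ im] ->.
  have [/andP[y1 y2] _] := yP i im.
  by rewrite (le_lt_trans (lo0 _ im) y1) (lt_le_trans y2 (hiB i)).
have gr : all (root g) s'.
  apply/allP => x /mapP[i]; rewrite mem_iota add0n => /andP[_ im] ->.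
  by have [] := yP i im.
have us' : uniq s'.
  by apply: sorted_uniq s'S; [exact: gap1_trans|move=> x; rewrite /gap1; lra].
have g0 : g != 0 by apply/eqP => g0; rewrite g0 horner0 ltxx in gB.
(* The [m + 1] roots found exhaust the degree allowed. *)
have gsz : size g = (size s').+1.
  by apply/anti_leq; rewrite max_poly_roots// size_mkseq andbT.
have gE := all_roots_prod_XsubC gsz gr (etrans (uniq_rootsE _) us').
exists s', (lead_coef g); split => //; last by rewrite size_mkseq.
move: gB; rewrite {1}gE hornerZ pmulr_lgt0// horner_prod big_seq prodr_gt0//.
by move=> x /s'B; rewrite !hornerE; lra.
Qed.

(** The invariant of the chains: [D] locates the roots, and [0 < c] fixes the signs of [f] that the
    next raising step needs. *)
Definition spaced_roots (D : R -> Prop) m f := exists s c,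
  [/\ 0 < c, f = c *: \prod_(x <- s) ('X - x%:P), sorted gap1 s,
      (forall x, x \in s -> D x) & size s = m].

Lemma spaced_roots1 D : spaced_roots D 0 1.
Proof.
by exists [::], 1; split => //; rewrite big_nil scale1r.
Qed.

Lemma seq_ubound s : exists B, forall x, x \in s -> x < B.
Proof.
elim: s => [|x s [B sB]]; first by exists 0.
exists (Num.max (x + 1) B) => y; rewrite in_cons lt_max.
by case/predU1P => [->|/sB->]; rewrite ?orbT// ltrDl ltr01.
Qed.

(** The step for weights on all naturals. No right endpoint is given, but the leading coefficient of
    the new polynomial is [A - mu] times that of [f], hence positive, so any large [B] serves in
    [raise_roots]. *)
Lemma spaced_roots_raise_pinfty A la mu m f : 0 <= mu < A -> 0 < la ->
  spaced_roots (fun x => 0 < x) m f ->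
  spaced_roots (fun x => 0 < x) m.+1
    (raise (A *: 'X) (la%:P + mu *: 'X) f).
Proof.
case/andP=> mu0 muA la0 [s [c [c0 fE sg s0 <-]]].
set g := raise _ _ f.
have sf : size f = (size s).+1.
  by rewrite fE size_scale ?gt_eqF// size_prod_XsubC.
have sf1 : size (f \Po ('X - 1%:P)) = (size s).+1.
  by rewrite size_comp_poly2// size_XsubC.
have lf : f`_(size s) = c.
  have /monicP : \prod_(x <- s) ('X - x%:P) \is monic.
    exact: monic_prod_XsubC.
  by rewrite lead_coefE size_prod_XsubC /= fE coefZ => ->; rewrite mulr1.
have lf1 : (f \Po ('X - 1%:P))`_(size s) = c.
  have := lead_coef_comp f (q := 'X - 1%:P).
  rewrite size_XsubC lead_coefXsubC expr1n mulr1 => /(_ isT).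
  by rewrite !lead_coefE sf sf1 /= lf.
have gS : (size g <= (size s).+2)%N.
  rewrite /g /raise (leq_trans (size_polyD _ _))// size_polyN geq_max.
  apply/andP; split; rewrite -?scalerAl ?mulrDl -?scalerAl.
    rewrite (leq_trans (size_scale_leq _ _))// mulrC.
    by rewrite size_mulX -?size_poly_eq0 sf1.
  rewrite (leq_trans (size_polyD _ _))// geq_max mul_polyC.
  rewrite !(leq_trans (size_scale_leq _ _)) ?sf//.
  by rewrite mulrC size_mulX -?size_poly_eq0 sf.
have gl : g`_(size s).+1 = (A - mu) * c.
  rewrite /g /raise mulrDl -!scalerAl mul_polyC coefB coefD !coefZ !coefXM /=.
  by rewrite lf lf1 [f`_ _]nth_default ?sf//; ring.
have lg : 0 < lead_coef g.
  have gl0 : 0 < g`_(size s).+1 by rewrite gl mulr_gt0 ?subr_gt0.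
  suff -> : lead_coef g = g`_(size s).+1 by [].
  rewrite lead_coefE; suff -> : size g = (size s).+2 by [].
  apply/anti_leq; rewrite gS /= ltnNge; apply/negP => /(nth_default 0) gs0.
  by rewrite gs0 ltxx in gl0.
have [B1 gB1] := polyrcf.poly_pinfty_gt_lc lg.
have [B2 sB2] := seq_ubound s.
pose B := Num.max (Num.max B1 1) (B2 + 1).
have [] := @raise_roots (A *: 'X) (la%:P + mu *: 'X) f s c B => //.
- move=> x xs; rewrite s0//= (lt_le_trans (sB2 _ xs))// lerBrDr.
  by rewrite le_max lexx orbT.
- by rewrite !lt_max ltr01 orbT.
- by rewrite hornerZ hornerX mulr0.
- by move=> x /andP[x0 _]; rewrite !hornerE mulr_gt0// (le_lt_trans mu0).
- by move=> x /andP[x0 _]; rewrite !hornerE ltr_wpDr// mulr_ge0.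
- by apply: lt_le_trans lg _; apply: gB1; rewrite !le_max lexx.
move=> s' [c' [c'0 gE sg' s'B ss']]; exists s', c'; split => //.
by move=> x /s'B/andP[].
Qed.

(** The step for finitely supported weights. As [V] vanishes at [B], the new polynomial has there
    the sign of [f] at [B - 1], a point beyond all roots of [f]. *)
Lemma spaced_roots_raise U V f m B :
    0 < B -> spaced_roots (fun x => 0 < x < B - 1) m f ->
    U.[0] = 0 -> (forall x, 0 < x <= B -> 0 < U.[x]) ->
    V.[B] = 0 -> (forall x, 0 <= x < B -> 0 < V.[x]) ->
    (size (raise U V f) <= m.+2)%N ->
  spaced_roots (fun x => 0 < x < B) m.+1 (raise U V f).
Proof.
move=> B0 [s [c [c0 fE sg sB <-]]] U0 Upos VB Vpos gS.
have [] := @raise_roots U V f s c B => //.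
- by move=> x /andP[x0 xB]; rewrite Upos// x0 ltW.
- rewrite raiseE VB mul0r subr0 mulr_gt0 ?Upos ?B0 ?lexx// fE hornerZ.
  rewrite mulr_gt0//.
  rewrite horner_prod big_seq prodr_gt0// => x /sB/andP[_].
  by rewrite !hornerE subr_gt0.
by move=> s' [c' [? ? ? ? ?]]; exists s', c'.
Qed.

Lemma spaced_roots_min_root_distance D m f k :
  spaced_roots D m f -> k != 0 ->
  exists2 d, min_root_distance (k *: f) d & (1 < d)%E.
Proof.
case=> s [c [c0 -> sg _ _]] k0; exists (min_gap s).
  exists s => //; split.
    by apply: sub_sorted sg => x y; rewrite /gap1; lra.
  rewrite !lead_coefZ.
  by rewrite (monicP (monic_prod_XsubC _ _ _)) mulr1 scalerA.
(* The minimum starts from [+oo], which settles the case of fewer than two roots. *)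
rewrite /min_gap; elim/big_ind : _ => //=.
  by rewrite ltry.
  by move=> x y x1 y1; rewrite lt_min x1 y1.
move=> i _; rewrite lte_fin ltrBrDl addrC.
have /(sortedP 0)/(_ i) := sg; rewrite /gap1 addrC; apply.
by case: i => i /=; rewrite ltn_predRL.
Qed.

End Roots.

(** * Linear maps prescribed on monomials, and divisibility *)

Section BasisMap.
Context {F : fieldType}.
Implicit Types (b : nat -> {poly F}) (p q C T : {poly F}).

Lemma poly_lin_ind (Q : {poly F} -> Prop) :
    Q 0 -> (forall i, Q 'X^i) ->
    (forall a p q, Q p -> Q q -> Q (a *: p + q)) ->
  forall p, Q p.
Proof.
move=> Q0 QX QL p; rewrite -[p]coefK poly_def.
by elim/big_rec : _ => // i q _ Qq; apply: QL.
Qed.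

Definition basis_map b C : {poly F} := \sum_(i < size C) C`_i *: b i.

Lemma basis_mapE b n C : (size C <= n)%N ->
  basis_map b C = \sum_(i < n) C`_i *: b i.
Proof.
move=> sn; rewrite /basis_map (big_ord_widen _ (fun i => C`_i *: b i) sn).
rewrite big_mkcond; apply: eq_bigr => i _; case: ltnP => // ?.
by rewrite nth_default// scale0r.
Qed.

Lemma basis_map_is_linear b : linear (basis_map b).
Proof.
move=> a p q; set n := maxn (size p) (size q).
have sn : (size (a *: p + q)%R <= n)%N.
  rewrite (leq_trans (size_polyD _ _))// geq_max leq_maxr andbT.
  by rewrite (leq_trans (size_scale_leq _ _))// leq_maxl.
rewrite (basis_mapE _ sn) (@basis_mapE _ n p) ?leq_maxl//.
rewrite (@basis_mapE _ n q) ?leq_maxr// scaler_sumr -big_split/=.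
by apply: eq_bigr => i _; rewrite coefD coefZ scalerA scalerDl.
Qed.

HB.instance Definition _ b :=
  GRing.isLinear.Build F {poly F} {poly F} _ (basis_map b)
    (basis_map_is_linear b).

Lemma basis_mapXn b i : basis_map b 'X^i = b i.
Proof.
rewrite (@basis_mapE _ i.+1) ?size_polyXn// big_ord_recr/= coefXn eqxx scale1r.
rewrite big1 ?add0r// => j _; rewrite coefXn ltn_eqF ?scale0r//.
Qed.

Lemma size_basis_map_le b C : (forall i, (size (b i) <= i.+1)%N) ->
  (size (basis_map b C) <= size C)%N.
Proof.
move=> sb; rewrite (leq_trans (size_sum _ _ _))//.
apply/bigmax_leqP => i _; rewrite (leq_trans (size_scale_leq _ _))//.
by rewrite (leq_trans (sb _)).
Qed.

(** The top coefficient of the image comes from [b] at the degree of [C] alone. Sizes are prescribed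
    only below [n] because for Krawtchouk [kap] vanishes once its index exceeds [N]. *)
Lemma basis_map_inj0 b n C : (forall i, (i < n)%N -> size (b i) = i.+1) ->
  (size C <= n)%N -> basis_map b C = 0 -> C = 0.
Proof.
move=> sb sC bC0; apply/eqP; rewrite -size_poly_eq0; apply: contraT.
rewrite -lt0n; case sCE : (size C) => [//|m] _.
have mn : (m < n)%N by rewrite -sCE.
have := congr1 (fun p => p`_m) bC0; rewrite coef0 /basis_map sCE.
rewrite big_ord_recr/= coefD coefZ coef_sum big1 ?add0r => [|i _]; last first.
  by rewrite coefZ [(b i)`_m]nth_default ?mulr0// sb// (ltn_trans _ mn).
have smb : size (b m) = m.+1 by rewrite sb.
move/eqP; rewrite mulf_eq0 => /orP[]; last first.
  have -> : (b m)`_m = lead_coef (b m) by rewrite lead_coefE smb.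
  by rewrite lead_coef_eq0 -size_poly_eq0 smb.
have -> : C`_m = lead_coef C by rewrite lead_coefE sCE.
by rewrite lead_coef_eq0 -size_poly_eq0 sCE.
Qed.

Lemma basis_map_surj b n p : (forall i, size (b i) = i.+1) ->
  (size p <= n)%N -> exists2 C : {poly F}, (size C <= n)%N & basis_map b C = p.
Proof.
move=> sb; elim: n p => [|n IHn] p sp.
  exists 0; rewrite ?size_poly0// raddf0.
  by apply/esym/eqP; rewrite -size_poly_leq0.
have bn0 : (b n)`_n != 0.
  have -> : (b n)`_n = lead_coef (b n) by rewrite lead_coefE sb.
  by rewrite lead_coef_eq0 -size_poly_eq0 sb.
pose a := p`_n / (b n)`_n.
have [|C sC CE] := IHn (p - a *: b n).
  apply/leq_sizeP => j; rewrite leq_eqVlt => /predU1P[<-|nj].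
    by rewrite coefB coefZ divfK ?subrr.
  by rewrite coefB coefZ !nth_default ?sb ?mulr0 ?subr0// (leq_trans sp).
exists (a *: 'X^n + C); last by rewrite linearP/= basis_mapXn CE; ring.
rewrite (leq_trans (size_polyD _ _))// geq_max (leq_trans sC)// andbT.
by rewrite (leq_trans (size_scale_leq _ _))// size_polyXn.
Qed.

(* An order [n] zero of [T] at [a] is detected by iterating a first order
   operator: away from the zeros of [th], it lowers the order by exactly 1. *)
Lemma dvdp_exp_XsubC_iter (nu th : {poly F}) (a : F) n T :
    (forall m, m.+1%:R != 0 :> F) -> th.[a] != 0 ->
    (forall i, (i < n)%N ->
      (iter i (fun S => nu * S + th * S^`()) T).[a] = 0) ->
  ('X - a%:P) ^+ n %| T.
Proof.
move=> ch tha; elim: n T => [|n IHn] T Tn; first by rewrite expr0 dvd1p.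
have [->|T0] := eqVneq T 0; first by rewrite dvdp0.
have [k [S /implyP/(_ T0) Sa TE]] := multiplicity_XsubC T a.
have Ta : T.[a] = 0 by exact: (Tn 0).
case: k => [|k] in TE.
  by move: Sa; rewrite /root -[S]mulr1 -[1](expr0 ('X - a%:P)) -TE Ta eqxx.
have /IHn : forall i, (i < n)%N ->
    (iter i (fun S => nu * S + th * S^`()) (nu * T + th * T^`())).[a] = 0.
  by move=> i ni; rewrite -iterSr; exact: Tn.
(* With T = (X - a)^(k+1) S, the operator gives (X - a)^k W, and W(a) = (k+1) th(a) S(a) is
   nonzero. *)
set W := k.+1%:R * (th * S) + ('X - a%:P) * (nu * S + th * S^`()).
have -> : nu * T + th * T^`() = W * ('X - a%:P) ^+ k.
  rewrite TE derivM deriv_exp derivXsubC mul1r /= exprS /W -mulr_natl; ring.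
have Wa : ~~ root W a.
  rewrite /root /W !hornerE subrr mul0r addr0 -[k.+1%:R]polyC_natr hornerC.
  by rewrite !mulf_neq0.
have W0 : W != 0 by apply: contraNneq Wa => ->; exact: root0.
move=> dv; rewrite TE; apply: dvdp_mull; apply: dvdp_exp2l; rewrite ltnS leqNgt.
apply/negP => kn; move: dv; rewrite -(subnKC kn) exprD exprSr -mulrA mulrC.
rewrite dvdp_mul2r ?expf_neq0 ?polyXsubC_eq0//.
move=> /(dvdp_trans (dvdp_mulr _ (dvdpp _))); rewrite dvdp_XsubCl.
exact/negP.
Qed.

Lemma dvdp_prod_exp_XsubC (I : eqType) (s : seq I) (t : I -> F)
    (n : I -> nat) T :
    uniq s -> {in s &, injective t} ->
    (forall j, j \in s -> ('X - (t j)%:P) ^+ n j %| T) ->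
  \prod_(j <- s) ('X - (t j)%:P) ^+ n j %| T.
Proof.
elim: s => [|i s IHs] /=; first by rewrite big_nil dvd1p.
case/andP=> is_ us tI dv; rewrite big_cons Gauss_dvdp.
  rewrite dv ?mem_head// IHs// => [j k js ks|j js].
    by apply: tI; rewrite in_cons ?js ?ks orbT.
  by rewrite dv// in_cons js orbT.
apply: coprimep_expl; rewrite coprimep_sym big_seq.
elim/big_rec : _ => [|j p js cp]; first by rewrite coprime1p.
rewrite coprimepMl cp andbT; apply: coprimep_expl.
rewrite coprimep_XsubC root_XsubC; apply: contraNneq is_ => tij.
by rewrite (tI i j) ?mem_head// in_cons js orbT.
Qed.

Lemma dvdp_size_scale p q : (size q <= size p)%N -> p %| q ->
  exists k, q = k *: p.
Proof.
move=> sqp /dvdpP[h qE]; have [p0|p0] := eqVneq p 0.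
  by exists 0; rewrite qE p0 mulr0 scaler0.
have [q0|q0] := eqVneq q 0; first by exists 0; rewrite q0 scale0r.
have h0 : h != 0 by apply: contraNneq q0 => h0; rewrite qE h0 mul0r.
have sh : (size h <= 1)%N.
  move: sqp; rewrite qE size_mul//; move: p0 h0; rewrite -!size_poly_gt0.
  case: (size p) (size h) => [|a] [|[|b]] // _ _.
  by rewrite leqNgt addSn /= addSn ltnS leq_addl.
by exists h`_0; rewrite qE {1}[h]size1_polyC// mul_polyC.
Qed.

Lemma basis_map_proportional b n C C' T k k' :
    (forall i, (i < n)%N -> size (b i) = i.+1) ->
    (size C <= n)%N -> (size C' <= n)%N ->
    basis_map b C = k *: T -> basis_map b C' = k' *: T -> k' != 0 ->
  C = (k / k') *: C'.
Proof.
move=> sb sC sC' bC bC' k'0; apply/eqP; rewrite -subr_eq0; apply/eqP.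
apply: (basis_map_inj0 sb).
  rewrite (leq_trans (size_polyD _ _))// size_polyN geq_max sC/=.
  exact: leq_trans (size_scale_leq _ _) sC'.
by rewrite linearB linearZ/= bC bC' scalerA divfK// subrr.
Qed.

End BasisMap.

(** * Newton coordinates and the raising chains *)

Section Newton.
Context {R : realType}.
Implicit Types (p C : {poly R}) (ts : seq R) (la mu t : R).

Definition falling i : {poly R} := \prod_(k < i) ('X - k%:R%:P).

Lemma size_falling i : size (falling i) = i.+1.
Proof.
rewrite /falling -(big_enum _ _ _ (fun k : 'I_i => 'X - (k%:R : R)%:P)) /=.
by rewrite size_prod_XsubC size_enum_ord.
Qed.

Lemma fallingS i : falling i.+1 = falling i * ('X - i%:R%:P).
Proof. by rewrite /falling big_ord_recr. Qed.

Lemma falling_shift i : 'X * (falling i \Po ('X - 1%:P)) = falling i.+1.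
Proof.
rewrite /falling big_ord_recl subr0 rmorph_prod; congr (_ * _).
apply: eq_bigr => k _ /=; rewrite comp_polyB comp_polyX comp_polyC.
by rewrite /bump /= natrD polyCD; ring.
Qed.

(** Newton coordinates suit both the weights, whose factorial moments are products, and the raising
    operators of [chain] and [meixner2_chain], which become first order differential operators on
    [C]. *)
Definition newton := basis_map falling.

HB.instance Definition _ := GRing.Linear.copy newton (basis_map falling).

Lemma newtonXn i : newton 'X^i = falling i. Proof. exact: basis_mapXn. Qed.

Lemma newton_mulX_shift C :
  newton ('X * C) = 'X * (newton C \Po ('X - 1%:P)).
Proof.
elim/(@poly_lin_ind R): C => [|i|a p q].
- by rewrite mulr0 !raddf0 mulr0.
- by rewrite -exprS !newtonXn falling_shift.
- rewrite mulrDr -scalerAr !linearP/= => -> ->.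
  by rewrite mulrDr -scalerAr.
Qed.

Lemma mulX_derivXn i : 'X * ('X^i)^`() = i%:R *: 'X^i :> {poly R}.
Proof.
rewrite derivXn mulrnAr -scaler_nat; case: i => [|i]; first by rewrite !scale0r.
by rewrite -exprS.
Qed.

Lemma newton_mulX C :
  'X * newton C = newton ('X * C + 'X * C^`()).
Proof.
elim/(@poly_lin_ind R): C => [|i|a p q].
- by rewrite !raddf0 !mulr0 addr0 raddf0.
- rewrite mulX_derivXn -exprS linearD linearZ/= !newtonXn fallingS -mul_polyC.
  by ring.
- rewrite mulrDr -scalerAr derivD derivZ !mulrDr -!scalerAr.
  rewrite [newton (a *: p + q)]linearP/= mulrDr -scalerAr => -> ->.
  by rewrite -linearP/=; congr newton; rewrite scalerDr addrACA.
Qed.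

Lemma newton_mulX_deriv C :
  newton ('X * C^`()) = 'X * newton C - newton ('X * C).
Proof. by rewrite newton_mulX linearD/= addrAC subrr add0r. Qed.

Lemma size_mulX_deriv C : (size ('X * C^`())%R <= size C)%N.
Proof.
have [->|C0] := eqVneq C 0; first by rewrite deriv0 mulr0.
rewrite (leq_trans (size_polyMleq _ _))// size_polyX /=.
by rewrite (leq_trans _ (lt_size_deriv C0)).
Qed.

Lemma size_mulX_le C : (size ('X * C)%R <= (size C).+1)%N.
Proof. by rewrite (leq_trans (size_polyMleq _ _))// size_polyX. Qed.

Lemma size_lincomb_le (a : R) p (q : {poly R}) m :
  (size p <= m)%N -> (size q <= m)%N ->
  (size (a *: p + q)%R <= m)%N.
Proof.
move=> sp sq; rewrite (leq_trans (size_polyD _ _))// geq_max sq andbT.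
by rewrite (leq_trans (size_scale_leq _ _)).
Qed.

(** The coefficient of the top term equals 1 in [chain] and c^-1 - 1 in [meixner2_chain]. *)
Lemma newton_raise A la mu C :
  raise (A *: 'X) (la%:P + mu *: 'X) (newton C) =
  newton ((A - mu) *: ('X * C) + (- la *: C + - mu *: ('X * C^`()))).
Proof.
rewrite !linearP/= linearZ /= newton_mulX_deriv newton_mulX_shift /raise.
by rewrite -!mul_polyC !polyCN polyCB; ring.
Qed.

Fixpoint rising (m : nat) : {poly R} :=
  if m is m'.+1 then rising m' * ('X + m'%:R%:P) else 1.

(* The Charlier, Krawtchouk and first Meixner families at once: their normalized
   falling factorial moments are [t ^ m * kap la mu m], with [(la, mu)] equal to
   [(1, 0)], [(N, -1)], [(beta, 1)] and [t] to [a], [p], [c / (1 - c)]. *)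
Fixpoint chain la mu ts : {poly R} :=
  if ts is t :: ts' then
    raise ((1 + mu * t) *: 'X) ((t * la)%:P + (t * mu) *: 'X)
      (chain (la + mu) mu ts')
  else 1.

Definition kap la mu i : R := \prod_(k < i) (la + mu * k%:R).

Lemma kapS la mu i : kap la mu i.+1 = kap la mu i * (la + mu * i%:R).
Proof. by rewrite /kap big_ord_recr. Qed.

(** Peeling off the first factor shifts [la]; this is why each step of [chain] continues with
    [la + mu]. *)
Lemma kap_shift la mu i : kap la mu i.+1 = la * kap (la + mu) mu i.
Proof.
rewrite /kap big_ord_recl mulr0 addr0; congr (_ * _).
by apply: eq_bigr => k _; rewrite lift0 -natr1; ring.
Qed.

(** The normalized moment of [newton C] as a polynomial in the parameter t of the weight. *)
Definition moment_poly la mu := basis_map (fun i => kap la mu i *: 'X^i).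

HB.instance Definition _ la mu :=
  GRing.Linear.copy (moment_poly la mu)
    (basis_map (fun i => kap la mu i *: 'X^i)).

Lemma moment_polyXn la mu i : moment_poly la mu 'X^i = kap la mu i *: 'X^i.
Proof. exact: basis_mapXn. Qed.

(** By linearity monomials suffice. On ['X^i] the two lower terms add up to [- t * kap la mu i.+1]
    times ['X^i], because [la + mu * i] is the next factor of [kap]. *)
Lemma moment_poly_raise la mu t C :
  moment_poly la mu ('X * C + (- (t * la) *: C + - (t * mu) *: ('X * C^`()))) =
  la *: (('X - t%:P) * moment_poly (la + mu) mu C).
Proof.
elim/(@poly_lin_ind R): C => [|i|a p q].
- by rewrite deriv0 !mulr0 !scaler0 !addr0 !linear0 mulr0 scaler0.
- rewrite mulX_derivXn -exprS !linearD !linearZ/= !moment_polyXn.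
  have kE : la%:P * (kap (la + mu) mu i)%:P =
      (kap la mu i)%:P * (la + mu * i%:R)%:P.
    by rewrite -!polyCM -kap_shift kapS.
  rewrite kapS exprS -!mul_polyC [RHS]mulrCA (mulrA la%:P) kE.
  by rewrite !(polyCN, polyCM, polyCD); ring.
- rewrite mulrDr derivD derivZ mulrDr -!scalerAr => Ep Eq.
  rewrite [moment_poly (la + mu) mu _]linearP/= mulrDr -scalerAr [RHS]scalerDr.
  rewrite [la *: (a *: _)]scalerA (mulrC la a) -[(a * la) *: _]scalerA.
  rewrite -Ep -Eq -linearP/=; congr moment_poly.
  by rewrite -!mul_polyC; ring.
Qed.

Lemma chain_newton la mu ts : exists2 C, chain la mu ts = newton C &
  (size C <= (size ts).+1)%N /\
  moment_poly la mu C = kap la mu (size ts) *: \prod_(t <- ts) ('X - t%:P).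
Proof.
elim: ts la => [|t ts IHts] la /=.
  exists 1; first by rewrite -[1](expr0 'X) newtonXn /falling big_ord0.
  by rewrite size_poly1 big_nil -[1 in LHS](expr0 'X) moment_polyXn.
have [C -> [sC CE]] := IHts (la + mu).
exists ('X * C + (- (t * la) *: C + - (t * mu) *: ('X * C^`()))).
  by rewrite newton_raise (_ : 1 + mu * t - t * mu = 1) ?scale1r//; ring.
split; last first.
  by rewrite moment_poly_raise CE big_cons kap_shift -scalerA -scalerAr.
rewrite -[X in X + _]scale1r !size_lincomb_le//.
- by rewrite (leq_trans (size_mulX_le _)).
- by rewrite (leq_trans sC).
- rewrite (leq_trans (size_scale_leq _ _))//.
  by rewrite (leq_trans (size_mulX_deriv _))// (leq_trans sC).
Qed.

Fixpoint meixner2_chain (c : R) bs : {poly R} :=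
  if bs is b :: bs' then
    raise (c^-1 *: 'X) (b%:P + 1 *: 'X) (meixner2_chain c bs')
  else 1.

(** The normalized moment as a polynomial in beta for fixed c: with u = c / (1 - c), the falling
    factorial moments are u^i (beta)_i. *)
Definition meixner2_poly (u : R) := basis_map (fun i => u ^+ i *: rising i).

HB.instance Definition _ u :=
  GRing.Linear.copy (meixner2_poly u) (basis_map (fun i => u ^+ i *: rising i)).

Lemma meixner2_polyXn u i : meixner2_poly u 'X^i = u ^+ i *: rising i.
Proof. exact: basis_mapXn. Qed.

Lemma meixner2_poly_raise u b C : u != 0 ->
  meixner2_poly u (u^-1 *: ('X * C) + (- b *: C + - 1 *: ('X * C^`()))) =
  ('X - b%:P) * meixner2_poly u C.
Proof.
move=> u0; elim/(@poly_lin_ind R): C => [|i|a p q].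
- by rewrite deriv0 !mulr0 !scaler0 !addr0 !linear0 mulr0.
- rewrite mulX_derivXn -exprS !linearD !linearZ/= !meixner2_polyXn.
  rewrite /= [u^-1 *: _]scalerA exprS mulKf// -!mul_polyC.
  by rewrite !(polyCN, polyCM, polyCD); ring.
- rewrite mulrDr derivD derivZ mulrDr -!scalerAr => Ep Eq.
  rewrite [meixner2_poly u (a *: p + q)]linearP/= mulrDr -scalerAr.
  rewrite -Ep -Eq -linearP/=; congr meixner2_poly.
  by rewrite -!mul_polyC; ring.
Qed.

Lemma meixner2_chain_newton c u bs : c != 0 -> u != 0 -> c^-1 - 1 = u^-1 ->
  exists2 C, meixner2_chain c bs = newton C &
  (size C <= (size bs).+1)%N /\
  meixner2_poly u C = \prod_(b <- bs) ('X - b%:P).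
Proof.
move=> c0 u0 cu; elim: bs => [|b bs [C CE [sC TE]]] /=.
  exists 1; first by rewrite -[1](expr0 'X) newtonXn /falling big_ord0.
  rewrite size_poly1 big_nil -[1 in LHS](expr0 'X) meixner2_polyXn.
  by rewrite scale1r.
exists (u^-1 *: ('X * C) + (- b *: C + - 1 *: ('X * C^`()))).
  by rewrite CE newton_raise cu.
split; last by rewrite meixner2_poly_raise// TE big_cons.
rewrite !size_lincomb_le//.
- by rewrite (leq_trans (size_mulX_le _)).
- by rewrite (leq_trans sC).
- rewrite (leq_trans (size_scale_leq _ _))//.
  by rewrite (leq_trans (size_mulX_deriv _))// (leq_trans sC).
Qed.

(* [nu] stands for [N], [b] for [beta + 1] and the entries of [ss] for the
   values [alpha_j + 1 + p], [p < n_j]. *)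
Fixpoint hahn_chain (b nu : R) ss : {poly R} :=
  if ss is s :: ss' then
    raise ('X * ((nu + b)%:P - 'X)) ((nu%:P - 'X) * ('X + s%:P))
      (hahn_chain (b + 1) (nu - 1) ss')
  else 1.

(** Both quadratic coefficients of [raise] have leading term -x^2, and x^2 (f(x) - f(x - 1)) has
    degree at most one more than [f], so each step raises the degree by at most 1. *)
Lemma size_hahn_chain b nu ss : (size (hahn_chain b nu ss) <= (size ss).+1)%N.
Proof.
suff [C -> sC] : exists2 C, hahn_chain b nu ss = newton C &
    (size C <= (size ss).+1)%N.
  rewrite (leq_trans (size_basis_map_le _ _))// => i.
  by rewrite size_falling.
elim: ss b nu => [|s ss IHss] b nu /=.
  exists 1; last by rewrite size_poly1.
  by rewrite -[1](expr0 'X) newtonXn /falling big_ord0.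
have [C -> sC] := IHss (b + 1) (nu - 1).
(* [D] is multiplication by x in Newton coordinates; the summand with coefficient 1 below is x^2
   (f(x) - f(x - 1)). *)
pose D (C : {poly R}) := 'X * C + 'X * C^`().
exists ((nu + b) *: ('X * C) +
   (1 *: D ('X * C^`()) + (- nu *: D C + (- (nu * s) *: C + s *: D C)))).
  have DE C' : newton (D C') = 'X * newton C' by rewrite newton_mulX.
  rewrite !linearP/= [newton (s *: _)]linearZ/= scale1r !DE /raise.
  rewrite newton_mulX_deriv !newton_mulX_shift -!mul_polyC.
  by rewrite !(polyCN, polyCM, polyCD); ring.
have sD (C' : {poly R}) : (size C' <= (size ss).+1)%N ->
    (size (D C') <= (size ss).+2)%N.
  move=> sC'; rewrite /D -['X * C']scale1r size_lincomb_le//.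
    by rewrite (leq_trans (size_mulX_le _)).
  by rewrite (leq_trans (size_mulX_deriv _))// (leq_trans sC').
rewrite !size_lincomb_le ?sD//.
- by rewrite (leq_trans (size_mulX_le _)).
- by rewrite (leq_trans (size_mulX_deriv _)).
- by rewrite (leq_trans sC).
- by rewrite (leq_trans (size_scale_leq _ _))// sD.
Qed.

End Newton.

(** * Roots of the chains, and uniqueness of the orthogonal polynomials *)

Section Chains.
Context {R : realType}.
Implicit Types (P C : {poly R}) (ts bs ss : seq R) (la mu t u x : R).

Lemma size_chain la mu ts : (size (chain la mu ts) <= (size ts).+1)%N.
Proof.
have [C -> [sC _]] := chain_newton la mu ts.
by rewrite (leq_trans (size_basis_map_le _ _))// => i; rewrite size_falling.
Qed.

Lemma chain_roots_pinfty la mu ts : 0 <= mu -> 0 < la ->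
  (forall t, t \in ts -> 0 < t) ->
  spaced_roots (fun x => 0 < x) (size ts) (chain la mu ts).
Proof.
move=> mu0; elim: ts la => [|t ts IHts] la la0 ts0 /=.
  exact: spaced_roots1.
have t0 : 0 < t by rewrite ts0 ?mem_head.
apply: spaced_roots_raise_pinfty; rewrite ?mulr_gt0//.
  by rewrite mulr_ge0 ?(ltW t0)//= [mu * t]mulrC ltrDr ltr01.
by apply: IHts => [|x xts]; rewrite ?ltr_wpDr// ts0// in_cons xts orbT.
Qed.

(** Here [V] is t (la - x), which vanishes at [la], and the inner chain has its roots below
    [la - 1], as [spaced_roots_raise] requires with [B = la]. *)
Lemma chain_roots_bounded la ts : (size ts)%:R <= la ->
  (forall t, t \in ts -> 0 < t < 1) ->
  spaced_roots (fun x => 0 < x < la) (size ts) (chain la (-1) ts).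
Proof.
elim: ts la => [|t ts IHts] la sla ts0 /=; first exact: spaced_roots1.
have /andP[t0 t1] : 0 < t < 1 by rewrite ts0 ?mem_head.
have la1 : 1 <= la by apply: le_trans sla; rewrite ler1n.
apply: (@spaced_roots_raise _ _ _ _ _ la).
- by rewrite (lt_le_trans ltr01).
- apply: IHts => [|x xts]; last by rewrite ts0// in_cons xts orbT.
  by rewrite lerBrDr natr1.
- by rewrite hornerZ hornerX mulr0.
- by move=> x /andP[x0 _]; rewrite hornerZ hornerX mulr_gt0//; lra.
- by rewrite !hornerE; ring.
- move=> x /andP[_ xla]; rewrite !hornerE mulrN1 mulNr -mulrBr.
  by rewrite mulr_gt0// subr_gt0.
- by have := size_chain la (-1) (t :: ts).
Qed.

Lemma meixner2_chain_roots c bs : 0 < c < 1 -> (forall b, b \in bs -> 0 < b) ->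
  spaced_roots (fun x => 0 < x) (size bs) (meixner2_chain c bs).
Proof.
case/andP=> c0 c1; elim: bs => [|b bs IHbs] bs0 /=; first exact: spaced_roots1.
apply: spaced_roots_raise_pinfty.
- by rewrite ler01 invf_gt1.
- by rewrite bs0 ?mem_head.
- by apply: IHbs => x xbs; rewrite bs0// in_cons xbs orbT.
Qed.

(** [V] vanishes at [nu], and the inner chain, run with [nu - 1], keeps its roots below [nu - 1].
    Positivity of [b] keeps [U] positive up to [nu] included. *)
Lemma hahn_chain_roots b nu ss : 0 < b -> (size ss)%:R <= nu ->
  (forall s, s \in ss -> 0 < s) ->
  spaced_roots (fun x => 0 < x < nu) (size ss) (hahn_chain b nu ss).
Proof.
elim: ss b nu => [|s ss IHss] b nu b0 snu ss0 /=; first exact: spaced_roots1.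
have s0 : 0 < s by rewrite ss0 ?mem_head.
have nu1 : 1 <= nu by apply: le_trans snu; rewrite ler1n.
apply: (@spaced_roots_raise _ _ _ _ _ nu).
- by rewrite (lt_le_trans ltr01).
- apply: IHss => [||x xss]; last by rewrite ss0// in_cons xss orbT.
    by rewrite addr_gt0.
  by rewrite lerBrDr natr1.
- by rewrite hornerM hornerX mul0r.
- by move=> x /andP[x0 xnu]; rewrite !hornerE mulr_gt0//; lra.
- by rewrite !hornerE; ring.
- by move=> x /andP[x0 xnu]; rewrite !hornerE mulr_gt0//; lra.
- by have := size_hahn_chain b nu (s :: ss).
Qed.

Lemma newton_surj n P : (size P <= n)%N ->
  exists2 C : {poly R}, (size C <= n)%N & newton C = P.
Proof. by apply: basis_map_surj => i; rewrite size_falling. Qed.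

Lemma newton_moment (L : {poly R} -> R) b t : scalar L ->
  (forall i, L (falling i) = (b i).[t] * L 1) ->
  forall C, L (newton C) = (basis_map b C).[t] * L 1.
Proof.
move=> Ll Lb C; elim/(@poly_lin_ind R): C => [|i|a p q].
- rewrite !linear0 horner0 mul0r; have := Ll (-1) 0 0.
  by rewrite scaler0 addr0 mulN1r addNr.
- by rewrite newtonXn Lb basis_mapXn.
- rewrite [newton (_ + _)]linearP [basis_map b (_ + _)]linearP/= Ll => -> ->.
  by rewrite hornerD hornerZ; ring.
Qed.

Definition pearson la mu (S : {poly R}) : {poly R} :=
  la *: 'X * S + ('X + mu *: 'X^2) * S^`().

Lemma moment_poly_mulX la mu C :
  moment_poly la mu ('X * C + 'X * C^`()) = pearson la mu (moment_poly la mu C).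
Proof.
rewrite /pearson; elim/(@poly_lin_ind R): C => [|i|a p q].
- by rewrite deriv0 !mulr0 addr0 !linear0 !mulr0 addr0.
- rewrite mulX_derivXn -exprS linearD linearZ/= !moment_polyXn derivZ.
  set d := 'X^i^`(); transitivity ((kap la mu i)%:P *
      (la%:P * 'X * 'X^i + (1 + mu%:P * 'X) * ('X * d))); last first.
    by rewrite -!mul_polyC; ring.
  rewrite mulX_derivXn kapS exprS -!mul_polyC.
  by rewrite !(polyCM, polyCD); ring.
- rewrite [moment_poly la mu (a *: p + q)]linearP/= !derivD !derivZ.
  rewrite !mulrDr -!scalerAr => Ep Eq.
  rewrite addrACA -!scalerDr !linearP/= Ep Eq.
  by rewrite -!mul_polyC; ring.
Qed.

(** By [moment_poly_mulX], orthogonality to x^p says that iterate [p] of [pearson] vanishes at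
    [t j], so [dvdp_exp_XsubC_iter] yields a zero of order [n j]. There [t j * (1 + mu * t j)] is
    the coefficient of the derivative. *)
Lemma dvdp_prod_moment_poly r (n : 'I_r -> nat) (t : 'I_r -> R)
    (L : 'I_r -> {poly R} -> R) la mu C :
    injective t -> (forall j, scalar (L j)) -> (forall j, L j 1 != 0) ->
    (forall j, t j * (1 + mu * t j) != 0) ->
    (forall j i, L j (falling i.+1) =
       t j * (la + mu * i%:R) * L j (falling i)) ->
    (forall j p, (p < n j)%N -> L j (newton C * 'X^p) = 0) ->
  \prod_(j < r) ('X - (t j)%:P) ^+ n j %| moment_poly la mu C.
Proof.
move=> tI Ll L1 t0 Lf LC.
apply: dvdp_prod_exp_XsubC => [|j k _ _|j _]; rewrite ?index_enum_uniq//.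
  exact: tI.
apply: (@dvdp_exp_XsubC_iter _ (la *: 'X) ('X + mu *: 'X^2)).
- by move=> m; rewrite pnatr_eq0.
- rewrite (_ : _.[_] = t j * (1 + mu * t j)); first exact: t0.
  by rewrite hornerD hornerZ hornerX hornerXn; ring.
move=> p pn; apply/eqP; rewrite -(mulIr_eq0 _ (mulIf (L1 j))).
have -> : iter p (fun S => la *: 'X * S + ('X + mu *: 'X^2) * S^`())
    (moment_poly la mu C) =
    moment_poly la mu (iter p (fun C => 'X * C + 'X * C^`()) C).
  by elim: p {pn} => //= p ->; rewrite moment_poly_mulX.
rewrite -(newton_moment (Ll j)) => [|i].
  rewrite -(LC j p pn); apply/eqP; congr (L j _).
  by elim: p {pn} => [|p IHp] /=; rewrite ?mulr1// -newton_mulX IHp exprS; ring.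
rewrite hornerZ hornerXn; elim: i => [|i IHi].
  by rewrite /falling /kap !big_ord0 expr0 !mul1r.
by rewrite Lf IHi kapS exprS; ring.
Qed.

(** The moment polynomial of [P] has degree at most [size ts] and is divisible by a product of that
    degree, so it is a multiple of it, as is that of the chain. In these degrees [moment_poly] is
    injective, since no factor of [kap] vanishes. *)
Lemma chain_unique r (n : 'I_r -> nat) (t : 'I_r -> R)
    (L : 'I_r -> {poly R} -> R) la mu ts P :
    \prod_(x <- ts) ('X - x%:P) = \prod_(j < r) ('X - (t j)%:P) ^+ n j ->
    injective t -> (forall j, scalar (L j)) -> (forall j, L j 1 != 0) ->
    (forall j, t j * (1 + mu * t j) != 0) ->
    (forall i, (i < size ts)%N -> la + mu * i%:R != 0) ->
    (forall j i, L j (falling i.+1) =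
       t j * (la + mu * i%:R) * L j (falling i)) ->
    (forall j p, (p < n j)%N -> L j (P * 'X^p) = 0) ->
    P != 0 -> (size P <= (size ts).+1)%N ->
  exists2 k, k != 0 & P = k *: chain la mu ts.
Proof.
move=> tsE tI Ll L1 t0 la0 Lf LP P0 sP.
have kap0 i : (i <= size ts)%N -> kap la mu i != 0.
  move=> is_; apply/prodf_neq0 => j _.
  by apply: la0; rewrite (leq_trans (ltn_ord j)).
have [C sC CE] := newton_surj sP.
have dv : \prod_(x <- ts) ('X - x%:P) %| moment_poly la mu C.
  by rewrite tsE (dvdp_prod_moment_poly tI Ll) ?CE.
have [|k kE] := dvdp_size_scale _ dv.
  rewrite size_prod_XsubC (leq_trans (size_basis_map_le _ _))// => i.
  by rewrite (leq_trans (size_scale_leq _ _)) ?size_polyXn.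
have [C' C'E [sC' kE']] := chain_newton la mu ts.
have E : C = (k / kap la mu (size ts)) *: C'.
  apply: (basis_map_proportional _ sC sC' kE kE') => [i|]; last exact: kap0.
  by rewrite ltnS => is_; rewrite size_scale ?kap0// size_polyXn.
exists (k / kap la mu (size ts)).
  by apply: contra_neq P0 => k0; rewrite -CE E k0 scale0r linear0.
by rewrite -CE E C'E linearZ.
Qed.

(** The same argument with simple zeros: the moment of [P], as a polynomial in the parameter,
    vanishes at each of the distinct [bs]. *)
Lemma meixner2_chain_unique c u (L : R -> {poly R} -> R) bs P :
    0 < c -> u != 0 -> c^-1 - 1 = u^-1 -> uniq bs ->
    (forall b, b \in bs -> scalar (L b)) ->
    (forall b, b \in bs -> L b 1 != 0) ->
    (forall b i, b \in bs ->
       L b (falling i.+1) = u * (b + i%:R) * L b (falling i)) ->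
    (forall b, b \in bs -> L b P = 0) ->
    P != 0 -> (size P <= (size bs).+1)%N ->
  exists2 k, k != 0 & P = k *: meixner2_chain c bs.
Proof.
move=> c0 u0 cu ubs Ll L1 Lf LP P0 sP.
have [C sC CE] := newton_surj sP.
have srising i : size (rising i : {poly R}) = i.+1.
  elim: i => [|i IHi] /=; first by rewrite size_poly1.
  rewrite size_Mmonic ?monicXaddC ?IHi ?size_XaddC ?addn2//.
  by rewrite -size_poly_eq0 IHi.
have rt : all (root (meixner2_poly u C)) bs.
  apply/allP => b bbs; apply/eqP; apply: (mulIf (L1 b bbs)); rewrite mul0r.
  rewrite -(LP b bbs) -CE.
  rewrite (@newton_moment _ (fun i => u ^+ i *: rising i) b (Ll b bbs))// => i.
  rewrite hornerZ; elim: i => [|i IHi].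
    by rewrite /falling big_ord0 expr0 hornerC !mul1r.
  by rewrite Lf// IHi exprS /= hornerM hornerD hornerX hornerC; ring.
have dv : \prod_(b <- bs) ('X - b%:P) %| meixner2_poly u C.
  by apply: uniq_roots_dvdp; rewrite ?uniq_rootsE.
have [|k kE] := dvdp_size_scale _ dv.
  rewrite size_prod_XsubC (leq_trans (size_basis_map_le _ _))// => i.
  by rewrite (leq_trans (size_scale_leq _ _)) ?srising.
have [C' C'E [sC' kE']] := meixner2_chain_newton bs (lt0r_neq0 c0) u0 cu.
have E : C = (k / 1) *: C'.
  rewrite -[RHS in _ = RHS]scale1r in kE'.
  apply: (basis_map_proportional _ sC sC' kE kE') => [i|]; last first.
    exact: oner_neq0.
  by move=> _; rewrite size_scale ?expf_neq0.
rewrite divr1 in E; exists k.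
  by apply: contra_neq P0 => k0; rewrite -CE E k0 scale0r linear0.
by rewrite -CE E C'E linearZ.
Qed.

End Chains.

(** * Integrals against discrete measures as sums and series *)

Section Integrals.
Context {R : realType}.
Implicit Types (w : nat -> R) (f : measurableTypeR R -> R) (p q : {poly R}).

Lemma ge0_integral_point_mass w k f : measurable_fun setT f ->
  (forall x, 0 <= f x) ->
  (\int[point_mass w k]_x (f x)%:E = (`|w k| * f k%:R)%:E)%E.
Proof.
move=> mf f0; rewrite ge0_integral_mscale//; last 2 first.
- exact/measurable_EFinP.
- by move=> x _; rewrite lee_fin.
rewrite integral_dirac//; last exact/measurable_EFinP.
by rewrite diracT mul1e EFinM.
Qed.

Lemma eseries_EFin (a : nat -> R) : cvgn (series a) ->
  (\sum_(k <oo) (a k)%:E = (limn (series a))%:E)%E.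
Proof.
move=> ca; rewrite -EFin_lim//; congr (limn _); apply/funext => n /=.
by rewrite /series/= sumEFin.
Qed.

Lemma integral_EFin_posneg
    (mu : {measure set (measurableTypeR R) -> \bar R}) f :
  (\int[mu]_x (f x)%:E =
   \int[mu]_x (Num.max (f x) 0)%:E - \int[mu]_x (Num.max (- f x) 0)%:E)%E.
Proof.
by rewrite integralE; congr (_ - _)%E; apply: eq_integral => x _;
  rewrite ?funeposE ?funenegE -EFin_max.
Qed.

Lemma integral_finite_discrete N w f : measurable_fun setT f ->
  (forall k, 0 <= w k) ->
  (\int[finite_discrete_measure N w]_x (f x)%:E =
   (\sum_(k < N.+1) w k * f k%:R)%:E)%E.
Proof.
move=> mf w0; rewrite integral_EFin_posneg.
have int (g : measurableTypeR R -> R) : measurable_fun setT g ->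
    (forall x, 0 <= g x) ->
  (\int[finite_discrete_measure N w]_x (g x)%:E =
   (\sum_(k < N.+1) w k * g k%:R)%:E)%E.
  move=> mg g0; rewrite ge0_integral_measure_sum//; last 2 first.
    by move=> x _; rewrite lee_fin.
    exact/measurable_EFinP.
  rewrite -sumEFin; apply: eq_bigr => k _.
  by rewrite ge0_integral_point_mass// ger0_norm.
rewrite !int ?EFinB -?sumrB.
- congr EFin; rewrite -sumrB; apply: eq_bigr => k _; rewrite -mulrBr.
  by congr (_ * _); case: (leP (f k%:R) 0); case: (leP (- f k%:R) 0); lra.
- by apply: measurable_maxr => //; exact: measurableT_comp.
- by move=> x; rewrite le_max lexx orbT.
- by apply: measurable_maxr.
- by move=> x; rewrite le_max lexx orbT.
Qed.

(** Nonnegative integrands can be integrated mass by mass. Absolute convergence makes the positive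
    and negative parts both finite, so their series may be subtracted. *)
Lemma integral_discrete w f : measurable_fun setT f ->
  (forall k, 0 <= w k) -> cvgn (series (fun k => w k * `|f k%:R|)) ->
  (\int[discrete_measure w]_x (f x)%:E =
   (limn (series (fun k => w k * f k%:R)))%:E)%E.
Proof.
move=> mf w0 cf; rewrite integral_EFin_posneg.
have cg (g : measurableTypeR R -> R) : (forall x, 0 <= g x <= `|f x|) ->
    cvgn (series (fun k => w k * g k%:R)).
  move=> gf; apply: series_le_cvg cf => k.
  - by rewrite mulr_ge0//; case/andP: (gf k%:R).
  - by rewrite mulr_ge0.
  - by rewrite ler_wpM2l//; case/andP: (gf k%:R).
have int (g : measurableTypeR R -> R) : measurable_fun setT g ->
    (forall x, 0 <= g x <= `|f x|) ->
  (\int[discrete_measure w]_x (g x)%:E =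
   (limn (series (fun k => w k * g k%:R)))%:E)%E.
  move=> mg gf; have g0 x : 0 <= g x by case/andP: (gf x).
  rewrite ge0_integral_measure_series//; last 2 first.
    by move=> x _; rewrite lee_fin.
    exact/measurable_EFinP.
  rewrite -eseries_EFin; last exact: cg.
  by apply: eq_eseriesr => k _; rewrite ge0_integral_point_mass// ger0_norm.
have bp x : 0 <= Num.max (f x) 0 <= `|f x|.
  by rewrite le_max lexx orbT ge_max ler_norm normr_ge0.
have bn x : 0 <= Num.max (- f x) 0 <= `|f x|.
  by rewrite le_max lexx orbT ge_max -normrN ler_norm normr_ge0.
rewrite !int// -?EFinB; last 2 first.
- by apply: measurable_maxr => //; exact: measurableT_comp.
- by apply: measurable_maxr.
rewrite -(lim_seriesB (cg _ bp) (cg _ bn)).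
congr (limn (series _))%:E; apply/funext => k /=; rewrite !fctE -mulrBr.
by congr (_ * _); case: (leP (f k%:R) 0); case: (leP (- f k%:R) 0); lra.
Qed.

End Integrals.

(** * Factorial moments of the weights *)

Section Moments.
Context {R : realType}.
Implicit Types (w : nat -> R) (p q P : {poly R}).

(** The cutoff [n] is excluded, so masses at 0, ..., N call for [N.+1]. *)
Definition partial_moment w n p := \sum_(k < n) w k * p.[k%:R].

Lemma partial_moment_is_linear w n : scalar (partial_moment w n).
Proof.
move=> a p q; rewrite /partial_moment mulr_sumr -big_split/=.
by apply: eq_bigr => k _; rewrite hornerD hornerZ; ring.
Qed.

Lemma falling_ge0 m k : 0 <= (falling m).[k%:R] :> R.
Proof.
have [km|mk] := ltnP k m.
  by rewrite horner_prod (bigD1 (Ordinal km))//= !hornerE subrr mul0r.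
rewrite horner_prod prodr_ge0// => i _.
by rewrite !hornerE subr_ge0 ler_nat ltnW// (leq_trans (ltn_ord i)).
Qed.

(* Summation by parts, from [x * (falling m)(x - 1) = (falling m.+1)(x)]. *)
Lemma partial_moment_falling w (rho la mu : R) n m :
    (forall k, k.+1%:R * w k.+1 = rho * (la + mu * k%:R) * w k) ->
  partial_moment w n.+1 (falling m.+1) =
  rho * (la + mu * m%:R) * partial_moment w n (falling m) +
  rho * mu * partial_moment w n (falling m.+1).
Proof.
move=> wS.
have FS k : (falling m.+1).[k.+1%:R] = k.+1%:R * (falling m).[k%:R] :> R.
  by rewrite -falling_shift hornerM hornerX horner_comp !hornerE -natr1 addrK.
rewrite /partial_moment big_ord_recl -falling_shift hornerM hornerX mul0r mulr0.
rewrite falling_shift add0r !mulr_sumr -big_split; apply: eq_bigr => k _ /=.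
rewrite -[bump 0 k]/(k.+1) FS (mulrA (w k.+1)) (mulrC (w k.+1)) wS.
by rewrite fallingS hornerM hornerXsubC; ring.
Qed.

Lemma partial_moment_nondecreasing w m : (forall k, 0 <= w k) ->
  {homo (fun n => partial_moment w n (falling m)) : i j /
    (i <= j)%N >-> i <= j}.
Proof.
move=> w0 i j /subnKC <-; elim: (j - i)%N => [|k IHk]; first by rewrite addn0.
rewrite (le_trans IHk)// addnS /partial_moment big_ord_recr /= lerDl.
by rewrite mulr_ge0 ?falling_ge0.
Qed.

Definition moment w p := limn (fun n => partial_moment w n p).

(** * Convergence of moments for weights with a first order recursion *)

Section Pearson.
Variables (w : nat -> R) (rho la mu : R).
Hypotheses (w0 : forall k, 0 <= w k) (w00 : 0 < w 0%N).
Hypotheses (rho0 : 0 <= rho) (la0 : 0 < la) (mu0 : 0 <= mu).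
Hypothesis rho_mu : rho * mu < 1.
Hypothesis wS : forall k, k.+1%:R * w k.+1 = rho * (la + mu * k%:R) * w k.

(** [partial_moment_falling] relates the cutoffs [n.+1] and [n]; these sums grow with the cutoff, so
    the first may be lowered to [n]. *)
Lemma partial_moment_step n m :
  (1 - rho * mu) * partial_moment w n (falling m.+1) <=
  rho * (la + mu * m%:R) * partial_moment w n (falling m).
Proof.
have := partial_moment_falling n m wS.
have := partial_moment_nondecreasing m.+1 w0 (leqnSn n) => /=.
lra.
Qed.

Lemma partial_moment_ge0 n m : 0 <= partial_moment w n (falling m).
Proof. by apply: sumr_ge0 => k _; rewrite mulr_ge0 ?falling_ge0. Qed.

(* The mass beyond [K] is at most [1 / K] times the first moment, which is in
   turn at most a constant times the total mass: take [K] large. *)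
Lemma total_mass_bounded :
  exists M, forall n, partial_moment w n (falling 0) <= M.
Proof.
set d := 1 - rho * mu; have d0 : 0 < d by rewrite subr_gt0.
have rl0 : 0 <= rho * la by rewrite mulr_ge0// ltW.
(* This makes [rho * la] less than half of [K * d], so that its contribution is absorbed on the
   left; hence the factor 2 in the final bound [2 * A]. *)
pose K := (Num.bound (2 * (rho * la) / d)).+1.
have KP : 2 * (rho * la) < K%:R * d.
  rewrite -ltr_pdivrMr// (lt_trans (archi_boundP _)) ?ltr_nat//.
  by apply: divr_ge0; [exact: mulr_ge0|exact: ltW].
have K0 : 0 < K%:R :> R by rewrite ltr0n.
pose A := partial_moment w K (falling 0).
(* A mass at k >= K contributes K w_k on the left and k w_k on the right. *)
have S01 n : K%:R * partial_moment w n (falling 0) <=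
    K%:R * A + partial_moment w n (falling 1).
  elim: n => [|n IHn].
    rewrite /partial_moment !big_ord0 mulr0 addr0 mulr_ge0 ?(ltW K0)//.
    exact: partial_moment_ge0.
  have [nK|Kn] := ltnP n K.
    have := partial_moment_nondecreasing 0 w0 nK.
    have := partial_moment_ge0 n.+1 1; rewrite -/A => h1 h2.
    by rewrite ler_wpDr// ler_wpM2l// ltW.
  rewrite /partial_moment !big_ord_recr/= -!/(partial_moment _ _ _).
  rewrite mulrDr addrA lerD// {1}/falling big_ord0 hornerC mulr1.
  rewrite /falling big_ord1 !hornerE mulrC ler_wpM2l//.
  by rewrite subr0 ler_nat.
exists (2 * A) => n; have := S01 n; have := partial_moment_step n 0.
rewrite mulr0 addr0 -/d; set S0 := partial_moment w n (falling 0).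
set S1 := partial_moment w n (falling 1).
move=> h1 h2; have S00 : 0 <= S0 := partial_moment_ge0 n 0.
have : d * (K%:R * S0) <= d * (K%:R * A) + rho * la * S0.
  by rewrite (le_trans (ler_wpM2l (ltW d0) h2))// mulrDr lerD2l.
move=> h3; have h4 : 2 * (rho * la) * S0 <= K%:R * d * S0.
  by rewrite ler_wpM2r// ltW.
have h5 : (K%:R * d) * S0 <= (K%:R * d) * (2 * A) by lra.
by rewrite -(ler_pM2l (mulr_gt0 K0 d0)).
Qed.

Lemma partial_moment_bounded m :
  exists M, forall n, partial_moment w n (falling m) <= M.
Proof.
elim: m => [|m [M MP]]; first exact: total_mass_bounded.
have d0 : 0 < 1 - rho * mu by rewrite subr_gt0.
exists (rho * (la + mu * m%:R) * M / (1 - rho * mu)) => n.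
rewrite ler_pdivlMr// mulrC (le_trans (partial_moment_step n m))//.
by rewrite ler_wpM2l// mulr_ge0// addr_ge0 ?(ltW la0)// mulr_ge0.
Qed.

Lemma is_cvg_partial_moment_falling m :
  cvgn (fun n => partial_moment w n (falling m)).
Proof.
apply: nondecreasing_is_cvgn; first exact: partial_moment_nondecreasing.
by have [M MP] := partial_moment_bounded m; exists M => _ [n _ <-].
Qed.

Lemma series_partial_moment p :
  series (fun k => w k * p.[k%:R]) = (fun n => partial_moment w n p).
Proof. by apply/funext => n; rewrite /series/= big_mkord. Qed.

(** Falling factorials are nonnegative on the naturals, so |p| is dominated there by its Newton
    expansion with coefficients replaced by their absolute values. *)
Lemma is_cvg_abs_moment p : cvgn (series (fun k => w k * `|p.[k%:R]|)).
Proof.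
have [C _ <-] := newton_surj (leqnn (size p)).
have h m : cvgn (series (fun k => w k * (falling m).[k%:R])).
  by rewrite series_partial_moment; exact: is_cvg_partial_moment_falling.
rewrite /newton /basis_map; elim: (size C) => [|n IHn].
  have -> : (fun k => w k * `|(\sum_(i < 0) C`_i *: falling i).[k%:R]|) = cst 0.
    by apply/funext => k; rewrite big_ord0 horner0 normr0 mulr0.
  by rewrite /series/=; under eq_fun do rewrite big1//; exact: is_cvg_cst.
have cv := is_cvg_seriesD IHn (is_cvg_seriesZ (k := `|C`_n|) (h n)).
apply: series_le_cvg cv => k; rewrite ?mulr_ge0// !fctE.
  by rewrite addr_ge0 ?mulr_ge0 ?falling_ge0.
rewrite big_ord_recr/= hornerD hornerZ.
rewrite (le_trans (ler_wpM2l (w0 k) (ler_normD _ _)))//.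
rewrite mulrDr lerD2l normrM (ger0_norm (falling_ge0 _ _)).
by rewrite mulrCA.
Qed.

Lemma is_cvg_moment p : cvgn (fun n => partial_moment w n p).
Proof.
rewrite -series_partial_moment; apply: normed_cvg.
have : cvgn (series (fun k => `|w k * p.[k%:R]|)).
  have -> : (fun k => `|w k * p.[k%:R]|) = (fun k => w k * `|p.[k%:R]|).
    by apply/funext => k; rewrite normrM (ger0_norm (w0 k)).
  exact: is_cvg_abs_moment.
exact.
Qed.

Lemma moment_is_linear : scalar (moment w).
Proof.
move=> a p q; apply/cvg_lim => //.
under eq_fun do rewrite partial_moment_is_linear.
by apply: cvgD; [apply: cvgMl_tmp|]; exact: is_cvg_moment.
Qed.

(** In the limit of [partial_moment_falling] the moment of order m + 1 stands on both sides. Solving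
    for it produces the parameter t = rho / (1 - rho mu): a for Charlier, c / (1 - c) for
    Meixner. *)
Lemma moment_falling m :
  moment w (falling m.+1) =
  rho / (1 - rho * mu) * (la + mu * m%:R) * moment w (falling m).
Proof.
have d0 : 1 - rho * mu != 0 by rewrite subr_eq0 eq_sym lt_eqF.
have c1 := @is_cvg_partial_moment_falling m.+1.
have c0 := @is_cvg_partial_moment_falling m.
have E : moment w (falling m.+1) = rho * (la + mu * m%:R) * moment w (falling m)
    + rho * mu * moment w (falling m.+1).
  rewrite {1}/moment; apply/cvg_lim => //.
  have : ((fun n => partial_moment w n.+1 (falling m.+1)) @ \oo -->
      rho * (la + mu * m%:R) * moment w (falling m)
      + rho * mu * moment w (falling m.+1))%classic.
    under eq_fun do rewrite (partial_moment_falling _ _ wS).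
    by apply: cvgD; apply: cvgMl_tmp; [exact: c0|exact: c1].
  by rewrite (cvg_shiftS (fun n => partial_moment w n (falling m.+1))).
apply: (mulfI d0); rewrite mulrBl mul1r {1}E addrK.
by field.
Qed.

Lemma moment1_gt0 : 0 < moment w 1.
Proof.
apply: (lt_le_trans w00); have c := @is_cvg_moment 1.
apply: limr_ge c _; exists 1%N => // n /= n1.
case: n n1 => // n _; rewrite /partial_moment big_ord_recl hornerC mulr1 lerDl.
by apply: sumr_ge0 => i _; rewrite hornerC mulr1.
Qed.

Lemma integral_discrete_poly p :
  (\int[discrete_measure w]_x (p.[x])%:E = (moment w p)%:E)%E.
Proof.
rewrite integral_discrete//; first by rewrite series_partial_moment.
  exact: measurable_poly.
exact: is_cvg_abs_moment.
Qed.

End Pearson.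
End Moments.

(** * Rising factorials and shifts of the weight parameter *)

Section Pochhammer.
Context {R : realType}.
Implicit Types (P q : {poly R}) (s b : R) (w : nat -> R).

Lemma pochhammerS s k : pochhammer s k.+1 = pochhammer s k * (s + k%:R).
Proof. by rewrite /pochhammer big_ord_recr. Qed.

Lemma pochhammer_shift s k : pochhammer s k.+1 = s * pochhammer (s + 1) k.
Proof.
rewrite /pochhammer big_ord_recl addr0; congr (_ * _).
by apply: eq_bigr => i _; rewrite lift0 -natr1 [i%:R + 1]addrC addrA.
Qed.

Lemma pochhammerD s k p :
  pochhammer s (k + p) = pochhammer s k * pochhammer (s + k%:R) p.
Proof.
elim: p => [|p IHp]; first by rewrite addn0 /pochhammer big_ord0 mulr1.
by rewrite addnS !pochhammerS IHp natrD -mulrA addrA.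
Qed.

Lemma pochhammer_gt0 s k : 0 < s -> 0 < pochhammer s k.
Proof. by move=> s0; apply: prodr_gt0 => i _; rewrite ltr_wpDr. Qed.

Definition shifted_rising s i : {poly R} := \prod_(k < i) ('X + (s + k%:R)%:P).

Lemma size_shifted_rising s i : size (shifted_rising s i) = i.+1.
Proof.
elim: i => [|i IHi]; first by rewrite /shifted_rising big_ord0 size_poly1.
rewrite /shifted_rising big_ord_recr/= -/(shifted_rising s i).
by rewrite size_Mmonic ?monicXaddC ?IHi ?size_XaddC ?addn2// -size_poly_eq0 IHi.
Qed.

(* Shifting the first parameter turns one weight tested against the rising
   factorials into a family of shifted weights tested against 1. *)
Lemma pochhammer_shifted_rising s i k :
  pochhammer s k * (shifted_rising s i).[k%:R] =
  pochhammer s i * pochhammer (s + i%:R) k.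
Proof.
rewrite -pochhammerD addnC pochhammerD; congr (_ * _).
rewrite /shifted_rising horner_prod; apply: eq_bigr => j _.
by rewrite hornerD hornerX hornerC addrCA addrA.
Qed.

Lemma partial_moment_mulr w w' (a : R) n q P :
    (forall k, (k < n)%N -> w k * q.[k%:R] = a * w' k) ->
  partial_moment w n (P * q) = a * partial_moment w' n P.
Proof.
move=> ww'; rewrite /partial_moment mulr_sumr; apply: eq_bigr => k _.
by rewrite hornerM mulrCA mulrC ww'// mulrA.
Qed.

(** Orthogonality can be tested on any basis graded by degree. This passes from monomials to
    [shifted_rising] for Meixner, and in the other direction for Hahn. *)
Lemma orthogonal_poly (L : {poly R} -> R) (b : nat -> {poly R}) n P :
    scalar L -> (forall i, size (b i) = i.+1) ->
    (forall i, (i < n)%N -> L (P * b i) = 0) ->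
  forall q, (size q <= n)%N -> L (P * q) = 0.
Proof.
move=> Ll sb Lb q sq; have [C sC <-] := basis_map_surj sb sq.
have L0 : L 0 = 0.
  by have := Ll (-1) 0 0; rewrite scaler0 addr0 mulN1r addNr.
rewrite /basis_map mulr_sumr.
have : forall i : 'I_(size C), L (P * b i) = 0.
  by move=> i; rewrite Lb// (leq_trans (ltn_ord i)).
elim/big_rec : _ => //= i p _ IH Lz.
by rewrite -scalerAr Ll Lz IH// mulr0 addr0.
Qed.

End Pochhammer.

(** * Parameter lists of the chains *)

Section Nodes.
Context {R : realType} {r : nat}.
Implicit Types (n : 'I_r -> nat) (x t : 'I_r -> R).

Definition repeated_nodes n t : seq R :=
  flatten [seq nseq (n j) (t j) | j <- index_enum 'I_r].

Lemma size_repeated_nodes n t : size (repeated_nodes n t) = multi_size n.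
Proof.
rewrite size_flatten /shape -map_comp sumnE big_map /multi_size.
by apply: eq_bigr => j _ /=; rewrite size_nseq.
Qed.

Lemma prod_repeated_nodes n t :
  \prod_(x <- repeated_nodes n t) ('X - x%:P) =
  \prod_(j < r) ('X - (t j)%:P) ^+ n j.
Proof.
rewrite big_flatten big_map; apply: eq_bigr => j _ /=.
by rewrite big_nseq iter_mulr_1.
Qed.

Lemma repeated_nodesP n t (y : R) :
  y \in repeated_nodes n t -> exists j, y = t j.
Proof. by move/flatten_mapP => [j _ /nseqP[->]]; exists j. Qed.

(** Orthogonality up to degree n_j - 1 for the weight with parameter x_j amounts to a vanishing
    integral of P itself for each parameter x_j + p with p < n_j. *)
Definition shifted_nodes n x : seq R :=
  [seq x j + p%:R | j <- index_enum 'I_r, p <- iota 0 (n j)].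

Lemma size_shifted_nodes n x : size (shifted_nodes n x) = multi_size n.
Proof.
rewrite size_allpairs_dep sumnE big_map /multi_size.
by apply: eq_bigr => j _ /=; rewrite size_iota.
Qed.

Lemma shifted_nodesP n x (y : R) :
  reflect (exists j p, (p < n j)%N /\ y = x j + p%:R) (y \in shifted_nodes n x).
Proof.
apply: (iffP allpairsPdep) => [[j [p [_ pn ->]]]|[j [p [pn ->]]]]; exists j, p.
  by rewrite mem_iota in pn.
by split; rewrite ?mem_index_enum ?mem_iota.
Qed.

Lemma shifted_nodes_uniq n x :
  (forall j s, j != s -> x j - x s \isn't a Num.int) ->
  uniq (shifted_nodes n x).
Proof.
move=> xn; apply: allpairs_uniq_dep => [|j _|]; rewrite ?index_enum_uniq//.
  exact: iota_uniq.
move=> [j p] [s q] _ _ /= E; have [js|/xn/negP[]] := eqVneq j s.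
  by subst s; move/addrI/eqP: E; rewrite eqr_nat => /eqP->.
have -> : x j - x s = q%:R - p%:R by move: E; lra.
by rewrite rpredB ?intr_nat ?natr_int.
Qed.

End Nodes.

(** * The Charlier, Meixner and Krawtchouk families *)

Section Families.
Context {R : realType} {r : nat}.
Implicit Types (n : 'I_r -> nat) (P : {poly R}).

Lemma type_II_functional
    (mu : 'I_r -> {measure set (measurableTypeR R) -> \bar R})
    (L : 'I_r -> {poly R} -> R) n P :
    (forall j p, (\int[mu j]_x (p.[x])%:E = (L j p)%:E)%E) ->
  type_II mu n P <->
  [/\ P != 0, (size P <= (multi_size n).+1)%N &
      forall j p, (p < n j)%N -> L j (P * 'X^p) = 0].
Proof.
move=> muL.
have E j p : (\int[mu j]_x (P.[x] * x ^+ p)%:E = (L j (P * 'X^p))%:E)%E.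
  by rewrite -muL; apply: eq_integral => x _; rewrite hornerM hornerXn.
split=> -[P0 sP ort]; split => // j p pn; last by rewrite E ort.
by have := ort j p pn; rewrite E => -[].
Qed.

Lemma integral_finite_discrete_poly N (w : nat -> R) (p : {poly R}) :
    (forall k, 0 <= w k) ->
  (\int[finite_discrete_measure N w]_x (p.[x])%:E =
   (partial_moment w N.+1 p)%:E)%E.
Proof.
by move=> w0; rewrite integral_finite_discrete//; exact: measurable_poly.
Qed.

Lemma charlier_gap (a : 'I_r -> R) n P :
    (forall j, 0 < a j) -> (forall j s, j != s -> a j != a s) ->
    type_II (fun j => charlier_measure (a j)) n P ->
  exists2 d, min_root_distance P d & (1 < d)%E.
Proof.
move=> a0 aI.
pose w j k : R := a j ^+ k / k`!%:R.
have w0 j k : 0 <= w j k by rewrite divr_ge0 ?exprn_ge0// ltW.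
have w00 j : 0 < w j 0%N by rewrite /w expr0 fact0 divr1.
have wS j k : k.+1%:R * w j k.+1 = a j * (1 + 0 * k%:R) * w j k.
  rewrite /w factS natrM exprS; field.
  by rewrite [1 + _]addrC natr1 !pnatr_eq0 -!lt0n fact_gt0.
have aj0 j : 0 <= a j by rewrite ltW.
have a1 j : a j * 0 < 1 :> R by rewrite mulr0.
move/(type_II_functional n P (fun j p => integral_discrete_poly
  (w0 j) (aj0 j) ltr01 (lexx 0) (a1 j) (wS j) p)) => [P0 sP LP].
have [||||||||||k k0 ->] := @chain_unique _ r n a (fun j => moment (w j)) 1 0
   (repeated_nodes n a) P.
- exact: prod_repeated_nodes.
- by move=> j s /eqP; apply: contraTeq => /aI.
- by move=> j; apply: moment_is_linear (wS j).
- by move=> j; rewrite gt_eqF//; apply: moment1_gt0 (wS j).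
- by move=> j; rewrite mul0r addr0 mulr1 gt_eqF.
- by move=> i _; rewrite mul0r addr0 oner_neq0.
- move=> j i.
  rewrite (moment_falling (w0 j) (aj0 j) ltr01 (lexx 0) (a1 j) (wS j)).
  by rewrite mulr0 subr0 divr1.
- exact: LP.
- exact: P0.
- by rewrite size_repeated_nodes.
apply: spaced_roots_min_root_distance k0; apply: chain_roots_pinfty => //.
by move=> t /repeated_nodesP[j ->].
Qed.

Lemma meixner_weight_ge0 (b c : R) k : 0 < b -> 0 < c < 1 ->
  0 <= pochhammer b k * c ^+ k / k`!%:R.
Proof.
move=> b0 /andP[c0 _].
by rewrite divr_ge0 ?mulr_ge0 ?exprn_ge0 ?(ltW c0) ?(ltW (pochhammer_gt0 _ _)).
Qed.

Lemma meixner_weight0 (b c : R) : 0 < pochhammer b 0 * c ^+ 0 / 0`!%:R.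
Proof. by rewrite /pochhammer big_ord0 expr0 mulr1 fact0 divr1. Qed.

Lemma meixner_weightS (b c : R) k :
  k.+1%:R * (pochhammer b k.+1 * c ^+ k.+1 / k.+1`!%:R) =
  c * (b + 1 * k%:R) * (pochhammer b k * c ^+ k / k`!%:R).
Proof.
rewrite pochhammerS factS natrM exprS; field.
by rewrite [1 + _]addrC natr1 !pnatr_eq0 -!lt0n fact_gt0.
Qed.

Lemma meixner1_gap (c : 'I_r -> R) (beta : R) n P :
    0 < beta -> (forall j, 0 < c j < 1) -> (forall j s, j != s -> c j != c s) ->
    type_II (fun j => meixner_measure beta (c j)) n P ->
  exists2 d, min_root_distance P d & (1 < d)%E.
Proof.
move=> b0 c01 cI.
pose w j k : R := pochhammer beta k * c j ^+ k / k`!%:R.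
have w0 j k : 0 <= w j k by exact: meixner_weight_ge0.
have w00 j : 0 < w j 0%N by exact: meixner_weight0.
have wS j k : k.+1%:R * w j k.+1 = c j * (beta + 1 * k%:R) * w j k.
  exact: meixner_weightS.
have cj0 j : 0 <= c j by case/andP: (c01 j) => /ltW.
have c1 j : c j * 1 < 1 by rewrite mulr1; case/andP: (c01 j).
move/(type_II_functional n P (fun j p => integral_discrete_poly
  (w0 j) (cj0 j) b0 ler01 (c1 j) (wS j) p)) => [P0 sP LP].
pose t j := c j / (1 - c j * 1).
have d0 j : 0 < 1 - c j by case/andP: (c01 j) => _; rewrite subr_gt0.
have t0 j : 0 < t j.
  by rewrite /t mulr1 divr_gt0//; case/andP: (c01 j).
have [||||||||||k k0 ->] := @chain_unique _ r n t (fun j => moment (w j)) beta 1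
   (repeated_nodes n t) P.
- exact: prod_repeated_nodes.
- move=> j s tE; apply/eqP; apply: contraT => /cI/eqP[].
  move: tE; rewrite /t !mulr1 => /eqP; rewrite eqr_div ?(gt_eqF (d0 _))//.
  by move/eqP; lra.
- by move=> j; apply: moment_is_linear (wS j).
- by move=> j; rewrite gt_eqF//; apply: moment1_gt0 (wS j).
- by move=> j; rewrite mul1r mulf_neq0 ?gt_eqF// addr_gt0.
- by move=> i _; rewrite mul1r gt_eqF// ltr_wpDr.
- move=> j i.
  by rewrite (moment_falling (w0 j) (cj0 j) b0 ler01 (c1 j) (wS j)).
- exact: LP.
- exact: P0.
- by rewrite size_repeated_nodes.
apply: spaced_roots_min_root_distance k0; apply: chain_roots_pinfty => //.
by move=> x /repeated_nodesP[j ->].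
Qed.

Lemma meixner2_gap (c : R) (beta : 'I_r -> R) n P :
    (forall j, 0 < beta j) -> 0 < c < 1 ->
    (forall j s, j != s -> beta j - beta s \isn't a Num.int) ->
    type_II (fun j => meixner_measure (beta j) c) n P ->
  exists2 d, min_root_distance P d & (1 < d)%E.
Proof.
move=> b0 c01 bZ; have /andP[c0 c1] := c01.
pose w b k : R := pochhammer b k * c ^+ k / k`!%:R.
have w0 b : 0 < b -> forall k, 0 <= w b k.
  by move=> b0' k; exact: meixner_weight_ge0.
have w00 b : 0 < w b 0%N by exact: meixner_weight0.
have wS b k : k.+1%:R * w b k.+1 = c * (b + 1 * k%:R) * w b k.
  exact: meixner_weightS.
have cm : c * 1 < 1 by rewrite mulr1.
move/(type_II_functional n P (fun j p => integral_discrete_poly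
  (w0 _ (b0 j)) (ltW c0) (b0 j) ler01 cm (wS (beta j)) p))
  => [P0 sP LP].
have lin b : 0 < b -> scalar (moment (w b)).
  by move=> b0'; apply: moment_is_linear (wS b); rewrite ?ltW//; exact: w0.
pose u := c / (1 - c * 1).
have d0 : 0 < 1 - c by rewrite subr_gt0.
have nodes_gt0 b : b \in shifted_nodes n beta -> 0 < b.
  by move/shifted_nodesP => [j [p [_ ->]]]; rewrite ltr_wpDr.
have [||||||||||k k0 ->] := @meixner2_chain_unique _ c u (fun b => moment (w b))
    (shifted_nodes n beta) P.
- exact: c0.
- by rewrite /u mulr1 mulf_neq0 ?invr_eq0 ?gt_eqF.
- by rewrite /u mulr1; field; rewrite !gt_eqF.
- exact: shifted_nodes_uniq.
- by move=> b /nodes_gt0; exact: lin.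
- move=> b /nodes_gt0 b0'; rewrite gt_eqF//.
  by apply: moment1_gt0 (wS b); rewrite ?ltW//; exact: w0.
- move=> b i /nodes_gt0 b0'.
  rewrite (moment_falling (w0 b b0') (ltW c0) b0' ler01 cm (wS b)).
  by rewrite mul1r.
(* Testing against [shifted_rising] in place of x^p moves the condition to the weight with parameter
   beta_j + p, tested against 1. *)
- move=> _ /shifted_nodesP[j [p [pn ->]]].
  have bp0 : 0 < beta j + p%:R by rewrite ltr_wpDr.
  have : moment (w (beta j)) (P * shifted_rising (beta j) p) = 0.
    apply: (orthogonal_poly (lin _ (b0 j)) (b := fun i => 'X^i) _ (LP j)).
      by move=> i; rewrite size_polyXn.
    by rewrite size_shifted_rising.
  have -> : moment (w (beta j)) (P * shifted_rising (beta j) p) =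
      pochhammer (beta j) p * moment (w (beta j + p%:R)) P.
    apply/cvg_lim => //.
    have E m : partial_moment (w (beta j)) m (P * shifted_rising (beta j) p) =
        pochhammer (beta j) p * partial_moment (w (beta j + p%:R)) m P.
      apply: partial_moment_mulr => k _; rewrite /w -!mulrA [RHS]mulrA.
      by rewrite -pochhammer_shifted_rising; ring.
    under eq_fun do rewrite E.
    apply: cvgMl_tmp.
    exact: (is_cvg_moment (w0 _ bp0) (ltW c0) bp0 ler01 cm (wS _)).
  by move/eqP; rewrite mulf_eq0 gt_eqF ?pochhammer_gt0//= => /eqP.
- exact: P0.
- by rewrite size_shifted_nodes.
apply: spaced_roots_min_root_distance k0; exact: meixner2_chain_roots.
Qed.

Lemma krawtchouk_gap N (p : 'I_r -> R) n P :
    (forall j, 0 < p j < 1) -> (forall j s, j != s -> p j - p s != 0) ->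
    (multi_size n <= N)%N ->
    type_II (fun j => krawtchouk_measure N (p j)) n P ->
  exists2 d, min_root_distance P d & (1 < d)%E.
Proof.
move=> p01 pI nN.
pose w j k : R := 'C(N, k)%:R * p j ^+ k * (1 - p j) ^+ (N - k).
have p0 j : 0 < p j by case/andP: (p01 j).
have q0 j : 0 < 1 - p j by rewrite subr_gt0; case/andP: (p01 j).
have w0 j k : 0 <= w j k by rewrite !mulr_ge0 ?exprn_ge0// ltW.
(* The factor [N - k] vanishes at [k = N], and the weight is zero beyond, so the recursion holds for
   every k. *)
have wS j k : k.+1%:R * w j k.+1 = p j / (1 - p j) * (N%:R + -1 * k%:R) * w j k.
  rewrite /w mulrA mulrA -natrM mul_bin_left natrM.
  have [kN|Nk] := ltnP k N; last first.
    rewrite leq_eqVlt in Nk; case/predU1P: Nk => [<-|Nk].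
      by rewrite subnn mul0r mulN1r subrr !(mulr0, mul0r).
    by rewrite bin_small// !(mulr0, mul0r).
  rewrite natrB ?(ltnW kN)// -[(N - k)%N](subnSK kN) !exprS.
  by field; rewrite gt_eqF.
move/(type_II_functional n P
  (fun j q => integral_finite_discrete_poly N q (w0 j))) => [P0 sP LP].
have [||||||||||k k0 ->] := @chain_unique _ r n p
   (fun j => partial_moment (w j) N.+1) N%:R (-1) (repeated_nodes n p) P.
- exact: prod_repeated_nodes.
- by move=> j s /eqP; apply: contraTeq => /pI; rewrite subr_eq0.
- by move=> j; exact: partial_moment_is_linear.
- move=> j; rewrite gt_eqF// /partial_moment big_ord_recl ltr_wpDr//.
    by apply: sumr_ge0 => i _; rewrite hornerC mulr1.
  by rewrite hornerC mulr1 /w bin0 mul1r expr0 mul1r exprn_gt0.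
- by move=> j; rewrite mulN1r mulf_neq0 ?gt_eqF.
- move=> i; rewrite size_repeated_nodes => iN.
  by rewrite mulN1r subr_eq0 eqr_nat gtn_eqF// (leq_trans iN).
- move=> j i.
  (* The mass at N + 1 is zero, so the cutoffs [N.+2] and [N.+1] give the same sum and the recursion
     can be solved for the next moment; rho / (1 + rho) is [p j]. *)
  have := partial_moment_falling N.+1 i (wS j).
  rewrite {1}/partial_moment big_ord_recr/= -/(partial_moment (w j) N.+1 _).
  have -> : w j N.+1 = 0 by rewrite /w bin_small// !mul0r.
  rewrite mul0r addr0 => E.
  move: (partial_moment _ _ _) (partial_moment _ _ _) E => y x E.
  have : (1 - p j) * x = p j * (N%:R + -1 * i%:R) * y - p j * x.
    by rewrite {1}E; field; rewrite gt_eqF.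
  lra.
- exact: LP.
- exact: P0.
- by rewrite size_repeated_nodes.
apply: spaced_roots_min_root_distance k0; apply: chain_roots_bounded.
  by rewrite size_repeated_nodes ler_nat.
by move=> x /repeated_nodesP[j ->].
Qed.

End Families.

(** * The Hahn family *)

Section Hahn.
Context {R : realType} {r : nat}.
Implicit Types (n : 'I_r -> nat) (P : {poly R}).

Definition hahn_weight (s b : R) N k : R :=
  pochhammer s k * pochhammer b (N - k) / (k`!%:R * (N - k)`!%:R).

Lemma hahn_weight_ge0 s b N k : 0 < s -> 0 < b -> 0 <= hahn_weight s b N k.
Proof.
move=> s0 b0; rewrite divr_ge0 ?mulr_ge0//.
by rewrite ltW// pochhammer_gt0.
by rewrite ltW// pochhammer_gt0.
Qed.

(** Summation by parts: the first coefficient vanishes at 0 and the second at N + 1, so after an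
    index shift both sums run over 0, ..., N. The coefficients of f(k) then differ by (s - t) b
    times the weight with [b + 1] and [N]. *)
Lemma hahn_moment_raise (s b t : R) N (f : {poly R}) : 0 < b ->
  partial_moment (hahn_weight s b N.+1) N.+2
    (raise ('X * ((N.+1%:R + b)%:P - 'X)) ((N.+1%:R%:P - 'X) * ('X + t%:P)) f) =
  (s - t) * b * partial_moment (hahn_weight s (b + 1) N) N.+1 f.
Proof.
move=> b0.
rewrite /partial_moment.
under eq_bigr do rewrite raiseE mulrBr.
rewrite sumrB big_ord_recl hornerM hornerX !mul0r mulr0 add0r.
rewrite [X in _ - X]big_ord_recr /= hornerM !hornerD hornerN hornerX hornerC.
rewrite subrr !mul0r mulr0 addr0 mulr_sumr -sumrB; apply: eq_bigr => k _.
have kN : (k <= N)%N by rewrite -ltnS.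
rewrite -[bump 0 k]/(k.+1) !hornerM !hornerD !hornerN !hornerX !hornerC.
rewrite -[X in f.[X - 1]]natr1 addrK /hahn_weight subSS pochhammerS subSn//.
rewrite pochhammer_shift.
have -> : N.+1%:R = k%:R + (N - k)%:R + 1 :> R by rewrite -natrD subnKC// natr1.
rewrite !factS !natrM -!natr1.
set j := (N - k)%N.
have Eb : b * pochhammer (b + 1) j = pochhammer b j * (b + j%:R).
  by rewrite -pochhammer_shift pochhammerS.
have bj0 : b + j%:R != 0 by rewrite gt_eqF// ltr_wpDr.
have -> : pochhammer b j = b * pochhammer (b + 1) j / (b + j%:R).
  by rewrite Eb mulfK.
field.
rewrite !natr1 !pnatr_eq0 -!lt0n !fact_gt0 /=.
exact: bj0.
Qed.

(** Each raising step with parameter t contributes a factor s - t, so the moment vanishes as soon as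
    s is met in [ss]. *)
Lemma hahn_moment_chain (s b : R) N ss :
  0 < b -> (size ss <= N)%N -> s \in ss ->
  partial_moment (hahn_weight s b N) N.+1 (hahn_chain b N%:R ss) = 0.
Proof.
elim: ss b N => [//|t ss IHss] b [//|N] b0 /= sN.
rewrite in_cons hahn_moment_raise// => /predU1P[->|sss].
  by rewrite subrr !mul0r.
by rewrite -[N.+1%:R]natr1 addrK IHss ?mulr0// addr_gt0.
Qed.

Lemma hahn_moment_shifted_rising (s b : R) N i P :
  partial_moment (hahn_weight s b N) N.+1 (P * shifted_rising s i) =
  pochhammer s i * partial_moment (hahn_weight (s + i%:R) b N) N.+1 P.
Proof.
apply: partial_moment_mulr => k _; rewrite /hahn_weight -!mulrA [RHS]mulrA.
by rewrite -pochhammer_shifted_rising; ring.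
Qed.

Lemma hahn_gap (alpha : 'I_r -> R) (beta : R) N n P :
    -1 < beta -> (forall j, -1 < alpha j) -> (multi_size n <= N)%N ->
    normal_index (fun j => hahn_measure (alpha j) beta N) n ->
    type_II (fun j => hahn_measure (alpha j) beta N) n P ->
  exists2 d, min_root_distance P d & (1 < d)%E.
Proof.
move=> beta1 alpha1 nN normal P_II.
pose s j := alpha j + 1; pose b := beta + 1.
have s0 j : 0 < s j by rewrite /s; have := alpha1 j; lra.
have b0 : 0 < b by rewrite /b; lra.
pose L j := partial_moment (hahn_weight (s j) b N) N.+1.
have II Q := type_II_functional n Q (fun j q =>
  integral_finite_discrete_poly N q (fun k => hahn_weight_ge0 N k (s0 j) b0)).
pose ss := shifted_nodes n s.
pose G := hahn_chain b N%:R ss.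
have ss0 x : x \in ss -> 0 < x.
  by move/shifted_nodesP => [j [p [_ ->]]]; rewrite ltr_wpDr.
have rG : spaced_roots (fun x => 0 < x < N%:R) (size ss) G.
  by apply: hahn_chain_roots => //; rewrite size_shifted_nodes ler_nat.
have G0 : G != 0.
  case: rG => l [c [c0 -> _ _ _]].
  by rewrite scaler_eq0 gt_eqF//= -size_poly_eq0 size_prod_XsubC.
have sG : (size G <= (multi_size n).+1)%N.
  by rewrite -(size_shifted_nodes n s); exact: size_hahn_chain.
have LG j (q : {poly R}) : (size q <= n j)%N -> L j (G * q) = 0.
  move=> sq; apply: (orthogonal_poly _ (size_shifted_rising (s j)) _ sq).
    exact: partial_moment_is_linear.
  move=> i ni; rewrite /L hahn_moment_shifted_rising hahn_moment_chain ?mulr0//.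
    by rewrite size_shifted_nodes.
  by apply/shifted_nodesP; exists j, i.
have G_II : type_II (fun j => hahn_measure (alpha j) beta N) n G.
  by apply/II; split => // j p pn; rewrite [LHS]LG// size_polyXn.
have lG := normal _ G_II; have lP := normal _ P_II.
have [P0 sP LP] := (II P).1 P_II.
(* [Q] cancels the coefficients of degree |n|. If nonzero it would be a type II polynomial of lower
   degree, against normality. *)
pose Q := lead_coef G *: P - lead_coef P *: G.
have [Q0|Q0] := eqVneq Q 0.
  have -> : P = (lead_coef P / lead_coef G) *: G.
    apply: (scalerI (a := lead_coef G)); first by rewrite lead_coef_eq0.
    rewrite scalerA mulrC divfK ?lead_coef_eq0//.
    by apply/eqP; rewrite -subr_eq0; apply/eqP.
  apply: spaced_roots_min_root_distance rG _.
  by rewrite mulf_neq0 ?invr_eq0 ?lead_coef_eq0.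
have sQ : (size Q <= (multi_size n).+1)%N.
  by rewrite /Q -scaleNr size_lincomb_le// (leq_trans (size_scale_leq _ _)).
have Q_II : type_II (fun j => hahn_measure (alpha j) beta N) n Q.
  apply/II; split => // j p pn.
  rewrite /Q mulrBl -!scalerAl -scaleNr partial_moment_is_linear.
  rewrite LP// mulr0 add0r -[_ *: _]addr0 partial_moment_is_linear.
  rewrite [X in _ * X]LG ?size_polyXn// mulr0 add0r.
  by rewrite /partial_moment big1// => k _; rewrite horner0 mulr0.
have : lead_coef Q = 0.
  rewrite lead_coefE (normal _ Q_II) /= /Q coefB !coefZ.
  have -> : P`_(multi_size n) = lead_coef P by rewrite lead_coefE lP.
  have -> : G`_(multi_size n) = lead_coef G by rewrite lead_coefE lG.
  by rewrite mulrC subrr.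
by move/eqP; rewrite lead_coef_eq0 (negPf Q0).
Qed.

End Hahn.

Theorem theorem3p27 (R : realType) (r : nat) (hr : (1 <= r)%N)
    (n : 'I_r -> nat) :
  [/\ (* multiple Hahn *)
      forall (alpha : 'I_r -> R) (beta : R) (N : nat) (P : {poly R}),
        (1 <= N)%N -> -1 < beta -> (forall j, -1 < alpha j) ->
        (forall j s, j != s -> alpha j - alpha s != 0) ->
        (multi_size n < N)%N ->
        normal_index (fun j => hahn_measure (alpha j) beta N) n ->
        type_II (fun j => hahn_measure (alpha j) beta N) n P ->
        exists2 d, min_root_distance P d & (1 < d)%E,
      (* multiple Krawtchouk *)
      forall (N : nat) (p : 'I_r -> R) (P : {poly R}),
        (1 <= N)%N -> (forall j, 0 < p j < 1) ->
        (forall j s, j != s -> p j - p s != 0) ->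
        (multi_size n < N)%N ->
        type_II (fun j => krawtchouk_measure N (p j)) n P ->
        exists2 d, min_root_distance P d & (1 < d)%E,
      (* multiple Charlier *)
      forall (a : 'I_r -> R) (P : {poly R}),
        (forall j, 0 < a j) ->
        (forall j s, j != s -> a j != a s) ->
        type_II (fun j => charlier_measure (a j)) n P ->
        exists2 d, min_root_distance P d & (1 < d)%E,
      (* multiple Meixner of the first kind *)
      forall (c : 'I_r -> R) (beta : R) (P : {poly R}),
        0 < beta -> (forall j, 0 < c j < 1) ->
        (forall j s, j != s -> c j != c s) ->
        type_II (fun j => meixner_measure beta (c j)) n P ->
        exists2 d, min_root_distance P d & (1 <= d)%E &
      (* multiple Meixner of the second kind *)
      forall (c : R) (beta : 'I_r -> R) (P : {poly R}),
        (forall j, 0 < beta j) -> 0 < c < 1 ->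
        (forall j s, j != s -> beta j - beta s \isn't a Num.int) ->
        type_II (fun j => meixner_measure (beta j) c) n P ->
        exists2 d, min_root_distance P d & (1 <= d)%E].
Proof.
split.
- move=> alpha beta N P _ beta1 alpha1 _ /ltnW nN.
  exact: hahn_gap.
- move=> N p P _ p01 pI /ltnW nN.
  exact: krawtchouk_gap.
- by move=> a P a0 aI; exact: charlier_gap.
- move=> c beta P beta0 c01 cI /(meixner1_gap beta0 c01 cI)[d Pd /ltW d1].
  by exists d.
- move=> c beta P beta0 c01 betaI /(meixner2_gap beta0 c01 betaI)[d Pd /ltW d1].
  by exists d.
Qed.
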